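(* Fix a device $n$, a frame $t$ and an iteration index $i$. In the probabilistic model given in the context (stationary two-state Markov activity with transition probabilities $p_{01},p_{11}$ and active probability $p_a\in(0,1)$, Rayleigh channels of variance $\beta>0$, Gaussian observations with variances $e_i^t, e_\infty^{t-1}, e_\infty^{t+1}>0$), let $\mathcal{S}_n^t=\{\mathbf{r}^{t-1}_{n,\infty},\mathbf{r}^{t+1}_{n,\infty}\}$. Then the MMSE-optimal denoising function $\boldsymbol{\eta}_{n,i}(\mathbf{r}^t_{n,i},\mathcal{S}^t_n)=\mathbb{E}[\mathbf{x}^t_n\mid \mathbf{r}^t_{n,i},\mathcal{S}^t_n]$ is given by $$\boldsymbol{\eta}_{n,i}(\mathbf{r}^t_{n,i},\mathcal{S}^t_n)=\frac{(1+e^t_i/\beta)^{-1}\,\mathbf{r}^t_{n,i}}{1+\phi^t_{n,i}(\mathbf{r}^t_{n,i},\mathcal{S}^t_n)},$$ where $$\phi^t_{n,i}(\mathbf{r}^t_{n,i},\mathcal{S}^t_n)=\upsilon^t_{n,i}\cdot\frac{1-p_a}{p_a}\cdot\frac{p_{01}+(1-p_{01})\upsilon^{t-1}_{n,\infty}}{p_{11}+(1-p_{11})\upsilon^{t-1}_{n,\infty}}\cdot\frac{p_{01}+(1-p_{01})\upsilon^{t+1}_{n,\infty}}{p_{11}+(1-p_{11})\upsilon^{t+1}_{n,\infty}},$$ and $\upsilon^t_{n,i}$ is the inverse likelihood ratio $$\upsilon^t_{n,i}=\frac{p(\mathbf{r}^t_{n,i}\mid\lambda^t_n=0)}{p(\mathbf{r}^t_{n,i}\mid\lambda^t_n=1)}=\left(\frac{\beta+e^t_i}{e^t_i}\right)^{M}\exp\left(-\Xi^t_i\|\mathbf{r}^t_{n,i}\|_2^2\right),\qquad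 \Xi^t_i=(e^t_i)^{-1}-(e^t_i+\beta)^{-1}.$$ The quantities $\upsilon^{\tau}_{n,\infty}$, $\tau\in\{t-1,t+1\}$, are given by the same formula with $\mathbf{r}^t_{n,i}$, $e^t_i$ replaced by $\mathbf{r}^\tau_{n,\infty}$, $e^\tau_\infty$.
   Context: Fix an integer $M\ge 1$ (number of antennas) and a real $\beta>0$. All vectors are row vectors in $\mathbb{C}^{1\times M}$, and $p(\cdot\mid\cdot)$ denotes conditional density with respect to Lebesgue measure on $\mathbb{C}^{1\times M}$. $\mathcal{CN}(0,\sigma\mathbf{I})$ denotes the circularly symmetric complex Gaussian law with density $(\pi\sigma)^{-M}\exp(-\|\mathbf{x}\|_2^2/\sigma)$. Activity: $(\lambda_n^\tau)_\tau$ is a stationary first-order Markov chain with values in $\{0,1\}$, with $p_{01}=\Pr(\lambda_n^{\tau+1}=1\mid\lambda_n^\tau=0)$ and $p_{11}=\Pr(\lambda_n^{\tau+1}=1\mid\lambda_n^\tau=1)$. Its stationary active probability is $p_a=\Pr(\lambda_n^\tau=1)\in(0,1)$, so that $p_a=p_{01}/(1-p_{11}+p_{01})$ whenever the denominator is nonzero. Channels: $\mathbf{x}_n^\tau=\lambda_n^\tau\mathbf{h}_n^\tau$ with $\mathbf{h}_n^\tau\sim\mathcal{CN}(0,\beta\mathbf{I})$. Observations (matched-filter outputs of the AMP iteration, modeled by state evolution with covariance equal to a scaled identity): $\mathbf{r}^t_{n,i}=\mathbf{x}^t_n+\sqrt{e^t_i}\,\mathbf{d}^t_n$ for the target frame $t$,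 and $\mathbf{r}^\tau_{n,\infty}=\mathbf{x}^\tau_n+\sqrt{e^\tau_\infty}\,\mathbf{d}^\tau_n$ for $\tau\in\{t-1,t+1\}$, where $\mathbf{d}^\tau_n\sim\mathcal{CN}(0,\mathbf{I})$ and $e^t_i,e^{t-1}_\infty,e^{t+1}_\infty>0$ are deterministic constants. The vectors $\mathbf{h}^{\tau}_n,\mathbf{d}^{\tau}_n$ for $\tau\in\{t-1,t,t+1\}$ are mutually independent and independent of the activity chain. *)

(* Defs.v *)
From HB Require Import structures.
From mathcomp Require Import all_boot all_order all_algebra.
From mathcomp Require Import all_classical all_reals all_analysis.
From mathcomp Require Import measurable_realfun complex.

Set Implicit Arguments.
Unset Strict Implicit.
Unset Printing Implicit Defensive.

Import Order.TTheory GRing.Theory Num.Theory.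
Import numFieldNormedType.Exports.

Local Open Scope classical_set_scope.
Local Open Scope complex_scope.
Local Open Scope ring_scope.

HB.instance Definition _ (R : realType) := isPointed.Build R[i] 0.

Section cvec_measurable.
Context (R : realType) (M : nat).

Definition cvec_coor (j : 'I_M) (x : 'rV[R[i]]_M) :
    measurableTypeR R * measurableTypeR R :=
  (complex.Re (x 0 j), complex.Im (x 0 j)).

(* The Borel sigma-algebra of C^M = (R * R)^M, generated by the coordinates as
   the library does for n.-tuple. *)
Definition cvec_measurable : set (set 'rV[R[i]]_M) :=
  g_sigma_preimage cvec_coor.

Let cvec_measurable0 : cvec_measurable set0.
Proof. by rewrite /cvec_measurable; exact: sigma_algebra0. Qed.

Let cvec_measurableC A : cvec_measurable A -> cvec_measurable (~` A).
Proof. by rewrite /cvec_measurable; exact: sigma_algebraC. Qed.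

Let cvec_measurable_bigcup (F : (set 'rV[R[i]]_M)^nat) :
  (forall k, cvec_measurable (F k)) -> cvec_measurable (\bigcup_k F k).
Proof. by rewrite /cvec_measurable; exact: sigma_algebra_bigcup. Qed.

HB.instance Definition _ := @isMeasurable.Build default_measure_display
  'rV[R[i]]_M cvec_measurable
  cvec_measurable0 cvec_measurableC cvec_measurable_bigcup.

End cvec_measurable.

Section cvec_measurable_theory.
Context (R : realType).

Lemma measurable_cvec_coor M (j : 'I_M) :
  measurable_fun [set: 'rV[R[i]]_M] (cvec_coor j).
Proof.
move=> _ Y mY; rewrite setTI; apply: sub_sigma_algebra => /=.
rewrite -bigcup_seq/=; exists j => /=; first by rewrite mem_index_enum.
by exists Y => //; rewrite setTI.
Qed.

Lemma measurable_fun_cvecP d (T : measurableType d) M (f : T -> 'rV[R[i]]_M) :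
  measurable_fun [set: T] f <->
  forall j, measurable_fun [set: T] (cvec_coor j \o f).
Proof.
split=> [mf j|mf].
  by apply: measurableT_comp => //; exact: measurable_cvec_coor.
suff H : forall A, cvec_measurable A -> measurable (f @^-1` A).
  by move=> _ A mA; rewrite setTI; exact: H.
move=> A mA.
suff /(_ _ mA) :
  @cvec_measurable R M `<=` [set B | measurable (f @^-1` B)] by [].
apply: smallest_sub.
  split => [|B mB|F mF] /=.
  - by rewrite preimage_set0.
  - by rewrite setTD; exact: measurableC.
  - by rewrite preimage_bigcup; apply: bigcup_measurable => k _; exact: mF.
rewrite -bigcup_seq => B [j _] [C mC <-] /=.
by rewrite setTI -comp_preimage -[X in measurable X]setTI; exact: mf.
Qed.

Definition cvec_cons M 
    (p : measurableTypeR R * measurableTypeR R * 'rV[R[i]]_M) :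
    'rV[R[i]]_(1 + M) :=
  row_mx (const_mx (p.1.1 +i* p.1.2)) p.2.

Definition cvec_uncons M (x : 'rV[R[i]]_(1 + M)) :
    measurableTypeR R * measurableTypeR R * 'rV[R[i]]_M :=
  (cvec_coor (lshift M ord0) x, rsubmx x).

Lemma cvec_consK M : cancel (@cvec_cons M) (@cvec_uncons M).
Proof.
move=> [[a b] x]; rewrite /cvec_uncons /cvec_cons /cvec_coor row_mxKr /=.
by rewrite row_mxEl mxE.
Qed.

Lemma cvec_unconsK M : cancel (@cvec_uncons M) (@cvec_cons M).
Proof.
move=> x; rewrite /cvec_uncons /cvec_cons -[RHS]hsubmxK; congr row_mx.
apply/matrixP => i j; rewrite !ord1 !mxE /=.
by case: (x _ _).
Qed.

Lemma measurable_cvec_cons M : measurable_fun setT (@cvec_cons M).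
Proof.
apply/measurable_fun_cvecP => j; case: (split_ordP j) => k ->.
  rewrite (_ : _ \o _ = fst)//.
  by apply/funext => -[[a b] x]; rewrite /cvec_coor /= row_mxEl mxE.
rewrite (_ : _ \o _ = cvec_coor k \o snd).
  by apply: measurableT_comp => //; exact: measurable_cvec_coor.
by apply/funext => -[[a b] x]; rewrite /cvec_coor /= row_mxEr.
Qed.

Lemma measurable_cvec_uncons M : measurable_fun setT (@cvec_uncons M).
Proof.
apply: measurable_fun_pair; first exact: measurable_cvec_coor.
apply/measurable_fun_cvecP => j.
rewrite (_ : _ \o _ = cvec_coor (rshift 1 j)).
  exact: measurable_cvec_coor.
by apply/funext => x; rewrite /cvec_coor /= !mxE.
Qed.

End cvec_measurable_theory.

Lemma product_measure_sigma_finite d1 d2 (T1 : measurableType d1)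
    (T2 : measurableType d2) (R : realType)
    (m1 : {sigma_finite_measure set T1 -> \bar R})
    (m2 : {sigma_finite_measure set T2 -> \bar R}) :
  sigma_finite setT (m1 \x m2)%E.
Proof.
have /sigma_finiteP[F [TF ndF Foo]] := sigma_finiteT m1.
have /sigma_finiteP[G [TG ndG Goo]] := sigma_finiteT m2.
exists (fun n => F n `*` G n).
  rewrite -setXTT TF TG predeqE => -[x y]; split.
    move=> [/= [n _ Fnx] [k _ Gky]]; exists (maxn n k) => //; split.
    - by move: x Fnx; exact/subsetPset/ndF/leq_maxl.
    - by move: y Gky; exact/subsetPset/ndG/leq_maxr.
  by move=> [n _ []/= ? ?]; split; exists n.
move=> k; have [? ?] := Foo k; have [? ?] := Goo k.
split; first exact: measurableX.
by rewrite product_measure1E// lte_mul_pinfty// ge0_fin_numE.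
Qed.

Section cvec_lebesgue.
Context (R : realType).

Definition plane_lebesgue :
    set (measurableTypeR R * measurableTypeR R) -> \bar R :=
  (@lebesgue_measure R \x @lebesgue_measure R)%E.

HB.instance Definition _ := Measure.on plane_lebesgue.
HB.instance Definition _ := Measure_isSigmaFinite.Build _ _ _
  plane_lebesgue (product_measure_sigma_finite _ _).

Section cvec_lebesgueS.
Context M (mu : {sigma_finite_measure set 'rV[R[i]]_M -> \bar R}).

Let muS : {measure set _ -> \bar R} := (plane_lebesgue \x mu)%E.

Definition cvec_lebesgueS : set 'rV[R[i]]_M.+1 -> \bar R :=
  pushforward muS (@cvec_cons R M).

Let lebesgueS0 : cvec_lebesgueS set0 = 0%E.
Proof. by rewrite /cvec_lebesgueS /pushforward preimage_set0 measure0. Qed.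

Let lebesgueS_ge0 A : (0 <= cvec_lebesgueS A)%E.
Proof. exact: (measure_ge0 muS). Qed.

Let lebesgueS_sigma_additive : semi_sigma_additive cvec_lebesgueS.
Proof.
exact: (@measure_semi_sigma_additive _ _ _
  (pushforward muS (mfun_Sub (mem_set (@measurable_cvec_cons R M))))).
Qed.

HB.instance Definition _ := isMeasure.Build _ _ _ cvec_lebesgueS
  lebesgueS0 lebesgueS_ge0 lebesgueS_sigma_additive.

Let lebesgueS_sigma_finite : sigma_finite setT cvec_lebesgueS.
Proof.
have [F FT Ffin] : sigma_finite setT muS.
  exact: product_measure_sigma_finite.
exists (fun k => @cvec_uncons R M @^-1` F k).
  by rewrite -preimage_bigcup -FT preimage_setT.
move=> k; split.
  rewrite -[X in measurable X]setTI.
  by apply: measurable_cvec_uncons => //; exact: (Ffin k).1.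
rewrite /cvec_lebesgueS /pushforward -comp_preimage.
rewrite (_ : _ \o _ = id) ?preimage_id; first exact: (Ffin k).2.
by apply/funext => p /=; rewrite cvec_consK.
Qed.

HB.instance Definition _ := Measure_isSigmaFinite.Build _ _ _
  cvec_lebesgueS lebesgueS_sigma_finite.

End cvec_lebesgueS.

(* Lebesgue measure on C^{1 x M} with C identified with R * R: the iterated
   product of the planar Lebesgue measure, one coordinate at a time. *)
Fixpoint cvec_lebesgue M : {sigma_finite_measure set 'rV[R[i]]_M -> \bar R} :=
  match M with
  | 0 => [the {sigma_finite_measure set _ -> \bar R} of \d_(0 : 'rV[R[i]]_0)]
  | M'.+1 => [the {sigma_finite_measure set _ -> \bar R}
                of cvec_lebesgueS (cvec_lebesgue M')]
  end.

End cvec_lebesgue.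

Section probabilistic_notions.
Context (R : realType) (d : measure_display) (T : measurableType d).
Variable P : probability T R.

(* P(A | E); only meaningful when P(E) > 0. *)
Definition cond_prob (A E : set T) : R := fine (P (A `&` E)) / fine (P E).

Definition mutually_independent (I : finType) (F : I -> set (set T)) : Prop :=
  forall (J : {set I}) (A : I -> set T),
    (forall k, k \in J -> F k (A k)) ->
    P (\bigcap_(k in [set` J]) A k) = (\prod_(k in J) P (A k))%E.

Definition process_sigma (l : nat -> {RV P >-> bool}) : set (set T) :=
  <<s \bigcup_tau g_sigma_algebra_preimage (l tau) >>.

Definition stationary (l : nat -> {RV P >-> bool}) : Prop :=
  forall (s n : nat) (b : nat -> bool),
    P (\bigcap_(k in `I_n) (l (s + k)%N @^-1` [set b k])) =
    P (\bigcap_(k in `I_n) (l k @^-1` [set b k])).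

Definition markov (l : nat -> {RV P >-> bool}) : Prop :=
  forall (n : nat) (b : nat -> bool) (c : bool),
    let past := \bigcap_(k in `I_n.+1) (l k @^-1` [set b k]) in
    P past != 0%E ->
    cond_prob (l n.+1 @^-1` [set c]) past =
    cond_prob (l n.+1 @^-1` [set c]) (l n @^-1` [set b n]).

Record activity_chain (l : nat -> {RV P >-> bool}) (p01 p11 pa : R) : Prop := {
  activity_stationary : stationary l;
  activity_markov : markov l;
  activity_p01 : forall tau,
    cond_prob (l tau.+1 @^-1` [set true]) (l tau @^-1` [set false]) = p01;
  activity_p11 : forall tau,
    cond_prob (l tau.+1 @^-1` [set true]) (l tau @^-1` [set true]) = p11;
  activity_pa : forall tau, P (l tau @^-1` [set true]) = pa%:E }.

Definition cRintegral (D : set T) (f : T -> R[i]) : R[i] :=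
  \int[P]_(w in D) complex.Re (f w) +i* \int[P]_(w in D) complex.Im (f w).

Definition cintegrable (f : T -> R[i]) : Prop :=
  P.-integrable setT (fun w => (complex.Re (f w))%:E) /\
  P.-integrable setT (fun w => (complex.Im (f w))%:E).

(* g is a version of z |-> E[X | Z = z], i.e. g \o Z is a version of E[X | Z]
   for the sigma-algebra { Z @^-1` B | B measurable } generated by Z. *)
Definition is_cond_exp d' (U : measurableType d') M
    (X : T -> 'rV[R[i]]_M) (Z : T -> U) (g : U -> 'rV[R[i]]_M) : Prop :=
  measurable_fun setT g /\
  forall j : 'I_M,
    [/\ cintegrable (fun w => X w 0 j),
        cintegrable (fun w => g (Z w) 0 j) &
        forall B : set U, measurable B ->
          cRintegral (Z @^-1` B) (fun w => g (Z w) 0 j) =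
          cRintegral (Z @^-1` B) (fun w => X w 0 j)].

Section vector_laws.
Context (M : nat).

Definition is_cond_density (X : T -> 'rV[R[i]]_M) (E : set T)
    (f : 'rV[R[i]]_M -> R) : Prop :=
  [/\ measurable_fun setT f,
      forall y, 0 <= f y &
      forall A, measurable A ->
        (cond_prob (X @^-1` A) E)%:E =
        (\int[cvec_lebesgue R M]_(y in A) (f y)%:E)%E].

Definition sqnorm (x : 'rV[R[i]]_M) : R :=
  \sum_(j < M) (complex.Re (x 0 j) ^+ 2 + complex.Im (x 0 j) ^+ 2).

Definition cnormal_pdf (sigma : R) (x : 'rV[R[i]]_M) : R :=
  (pi * sigma) ^- M * expR (- (sqnorm x / sigma)).

Definition has_cnormal_law (X : T -> 'rV[R[i]]_M) (sigma : R) : Prop :=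
  forall A, measurable A ->
    P (X @^-1` A) =
    (\int[cvec_lebesgue R M]_(y in A) (cnormal_pdf sigma y)%:E)%E.

(* v = p(. | l = 0) / p(. | l = 1). Conditional densities are only determined
   up to Lebesgue-null sets, hence the quantification over all versions. *)
Definition is_inverse_likelihood_ratio (X : T -> 'rV[R[i]]_M) (l : T -> bool)
    (v : 'rV[R[i]]_M -> R) : Prop :=
  [/\ exists p0, is_cond_density X (l @^-1` [set false]) p0,
      exists p1, is_cond_density X (l @^-1` [set true]) p1 &
      forall p0 p1,
        is_cond_density X (l @^-1` [set false]) p0 ->
        is_cond_density X (l @^-1` [set true]) p1 ->
        {ae cvec_lebesgue R M, forall y, p0 y / p1 y = v y}].

Definition signal (l : nat -> {RV P >-> bool})
    (h : nat -> {RV P >-> 'rV[R[i]]_M}) (tau : nat) (w : T) : 'rV[R[i]]_M :=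
  (l tau w)%:R *: h tau w.

Definition observation (l : nat -> {RV P >-> bool})
    (h z : nat -> {RV P >-> 'rV[R[i]]_M}) (e : R) (tau : nat) (w : T) :
    'rV[R[i]]_M :=
  signal l h tau w + (Num.sqrt e)%:C *: z tau w.

(* The seven independent sources around frame t > 0: None is the whole activity
   chain; (true, k) and (false, k) are the channel and the noise of frame
   t - 1 + k. *)
Definition source_sigma (t : nat) (l : nat -> {RV P >-> bool})
    (h z : nat -> {RV P >-> 'rV[R[i]]_M}) (s : option (bool * 'I_3)) :
    set (set T) :=
  match s with
  | None => process_sigma l
  | Some (true, k) => g_sigma_algebra_preimage (h (t.-1 + k)%N)
  | Some (false, k) => g_sigma_algebra_preimage (z (t.-1 + k)%N)
  end.

End vector_laws.
End probabilistic_notions.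

Section denoiser.
Context (R : realType) (M : nat).

Definition upsilon (beta e : R) (y : 'rV[R[i]]_M) : R :=
  ((beta + e) / e) ^+ M * expR (- ((e^-1 - (e + beta)^-1) * sqnorm y)).

Definition phi (p01 p11 pa v vprev vnext : R) : R :=
  v * ((1 - pa) / pa)
    * ((p01 + (1 - p01) * vprev) / (p11 + (1 - p11) * vprev))
    * ((p01 + (1 - p01) * vnext) / (p11 + (1 - p11) * vnext)).

(* y is the observation of the target frame, s.1 and s.2 those of the previous
   and of the next frame. *)
Definition mmse_denoiser (beta p01 p11 pa e eprev enext : R) (y : 'rV[R[i]]_M)
    (s : 'rV[R[i]]_M * 'rV[R[i]]_M) : 'rV[R[i]]_M :=
  ((1 + e / beta)^-1 /
   (1 + phi p01 p11 pa (upsilon beta e y)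
          (upsilon beta eprev s.1) (upsilon beta enext s.2)))%:C *: y.

End denoiser.

(* Main.v *)
(* Given the three activities, the observations are independent Gaussians, so by the
   Markov property and the reversibility of a stationary two-state chain the joint
   density of the observations on {lambda^t = b} factorises over the frames; the ratio
   of these densities for b = 0 and b = 1 is phi.  When the device is active,
   h = (h - c r) + c r with c = beta / (beta + e), where h - c r is a centred Gaussian
   independent of r and of the neighbouring frames.  Integrating over an event of the
   observations thus replaces x = lambda h by c r on {lambda^t = 1}, and the
   factor 1 / (1 + phi) is the posterior probability of activity. *)
Require Import Defs.
From HB Require Import structures.
From mathcomp Require Import all_boot all_order all_algebra.
From mathcomp Require Import all_classical all_reals all_analysis.
From mathcomp Require Import measurable_realfun complex.
From mathcomp Require Import ring lra.

Set Implicit Arguments.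
Unset Strict Implicit.
Unset Printing Implicit Defensive.

Import Order.TTheory GRing.Theory Num.Theory.
Import numFieldNormedType.Exports.

Local Open Scope classical_set_scope.
Local Open Scope complex_scope.
Local Open Scope ring_scope.

(** * Densities and product measures *)

(** Independence is available only as a product formula on events of the seven sources, that is on
    rectangles, whereas [r] and the residual [h - c r] both mix a channel with a noise. The formula
    is therefore extended to arbitrary measurable sets of pairs by uniqueness of finite measures on
    a pi-system. Auxiliary events (activities, an event of the residual) are carried along as a set
    to intersect with and a constant factor, so that one joint law gives both the density of the
    observations and the independence of the residual. No Gaussian integral is computed: mass one
    comes from the assumed law of a channel by scaling, mean zero from the symmetry [x -> - x].
    Since complex integrals are taken componentwise, the final argument is run for one real
    functional [u], a real or imaginary part of a coordinate. Its integrals are moved to the space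
    of observations, where the claim becomes a pointwise identity of densities. *)

Section density.
Local Open Scope ereal_scope.
Context d (T : measurableType d) (R : realType).

Section measure_of_density.
Variables (mu : {measure set T -> \bar R}) (f : T -> R).
Hypotheses (mf : measurable_fun setT f) (f0 : forall x, (0 <= f x)%R).

(** Measurability and nonnegativity are arguments so that the measure structure declared below is
    found by unification from the term alone. *)
Definition mdensity of measurable_fun setT f & (forall x, (0 <= f x)%R) :=
  fun A : set T => \int[mu]_(x in A) (f x)%:E.

Local Notation nu := (mdensity mf f0).

Let mdensity0 : nu set0 = 0.
Proof. by rewrite /mdensity integral_set0. Qed.

Let mdensity_ge0 A : 0 <= nu A.
Proof. by apply: integral_ge0 => x _; rewrite lee_fin. Qed.

Let mdensity_sigma_additive : semi_sigma_additive nu.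
Proof.
move=> F mF tF mUF; rewrite /mdensity ge0_integral_bigcup//=.
- by apply: is_cvg_ereal_nneg_natsum_cond => n _ _; exact: mdensity_ge0.
- exact/measurable_EFinP/measurable_funTS.
- by move=> x _; rewrite lee_fin.
Qed.

HB.instance Definition _ := isMeasure.Build _ _ _ nu
  mdensity0 mdensity_ge0 mdensity_sigma_additive.

End measure_of_density.

Section integral_density.
Variables (nu mu : {measure set T -> \bar R}) (f : T -> R).
Hypotheses (mf : measurable_fun setT f) (f0 : forall x, (0 <= f x)%R).
Hypothesis nuE :
  forall A, measurable A -> nu A = \int[mu]_(x in A) (f x)%:E.

Import HBNNSimple.

Let mEf : measurable_fun setT (EFin \o f).
Proof. exact/measurable_EFinP. Qed.

Let integral_density_nnsfun (h : {nnsfun T >-> R}) :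
  \int[nu]_x (h x)%:E = \int[mu]_x ((h x)%:E * (f x)%:E).
Proof.
under [LHS]eq_integral do rewrite fimfunE -fsumEFin//.
rewrite [LHS]ge0_integral_fsum//; last 2 first.
  - by move=> r; exact/measurable_EFinP/measurableT_comp.
  - by move=> n x _; rewrite EFinM nnfun_muleindic_ge0.
under [RHS]eq_integral.
  move=> x xD; rewrite fimfunE -fsumEFin// muleC ge0_mule_fsumr; last first.
    by move=> r; rewrite EFinM nnfun_muleindic_ge0.
  over.
rewrite [RHS]ge0_integral_fsum//; last 2 first.
  - move=> r; apply: emeasurable_funM => //.
    by apply/measurable_EFinP; apply/measurableT_comp.
  - move=> n x _; apply: mule_ge0; first by rewrite lee_fin.
    by rewrite EFinM nnfun_muleindic_ge0.
apply: eq_fsbigr => r _; rewrite integralZl_indic_nnsfun// integral_indic//.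
rewrite setIT nuE// integral_mkcond epatch_indic.
have [r0|r0] := ltP r 0%R.
  rewrite preimage_nnfun0// indic0 integral0_eq ?mule0; last first.
    by move=> x _; rewrite mule0.
  by rewrite integral0_eq// => x _; rewrite /= mulr0 mule0.
rewrite -ge0_integralZl//.
- by apply: eq_integral => x _; rewrite EFinM muleCA.
- by apply: emeasurable_funM => //; exact/measurable_EFinP.
- by move=> x _; rewrite mule_ge0// lee_fin.
Qed.

(** After extending [g] by zero outside [D], both sides are limits along the same approximating
    simple functions, by monotone convergence. *)
Lemma ge0_integral_density (D : set T) (g : T -> \bar R) : measurable D ->
  measurable_fun D g -> (forall x, D x -> 0 <= g x) ->
  \int[nu]_(x in D) g x = \int[mu]_(x in D) (g x * (f x)%:E).
Proof.
move=> mD mg g0; rewrite integral_mkcond [RHS]integral_mkcond.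
have -> : ((fun x => g x * (f x)%:E) \_ D) = (fun x => (g \_ D) x * (f x)%:E).
  by apply/funext => x; rewrite !patchE; case: ifP => //; rewrite mul0e.
have {mg} : measurable_fun setT (g \_ D) by exact/(measurable_restrictT _ _).1.
have {g0} : forall x, 0 <= (g \_ D) x by exact: erestrict_ge0.
move: (g \_ D) => {D mD}g g0 mg.
pose h := nnsfun_approx measurableT mg.
have hg x : limn (fun n => (h n x)%:E) = g x.
  by apply/cvg_lim => //; exact: cvg_nnsfun_approx.
transitivity (limn (fun n => \int[nu]_x (h n x)%:E)).
  rewrite -monotone_convergence//=.
  - by apply: eq_integral => x _; rewrite hg.
  - by move=> n; exact/measurable_EFinP.
  - by move=> n x _; rewrite lee_fin.
  - by move=> x _ a b ab; rewrite lee_fin; exact/lefP/nd_nnsfun_approx.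
under eq_fun do rewrite integral_density_nnsfun.
rewrite -monotone_convergence//=.
- apply: eq_integral => x _; apply/cvg_lim => //.
  apply: cvgeZr => //; exact: cvg_nnsfun_approx.
- by move=> n; apply: emeasurable_funM => //; exact/measurable_EFinP.
- by move=> n x _; rewrite mule_ge0// lee_fin.
- move=> x _ a b ab; rewrite lee_wpmul2r ?lee_fin//.
  exact/lefP/nd_nnsfun_approx.
Qed.

Lemma integral_density (D : set T) (g : T -> R) : measurable D ->
  measurable_fun D g ->
  \int[nu]_(x in D) (g x)%:E = \int[mu]_(x in D) (g x * f x)%:E.
Proof.
move=> mD mg; rewrite integralE [RHS]integralE.
have mEg : measurable_fun D (EFin \o g) by exact/measurable_EFinP.
rewrite !ge0_integral_density//; last 2 first.
- exact: measurable_funeneg.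
- exact: measurable_funepos.
congr (_ - _); apply: eq_integral => x _.
- by rewrite !funeposE !EFinM maxe_pMl ?lee_fin// mul0e.
- by rewrite !funenegE !EFinM -mulNe maxe_pMl ?lee_fin// mul0e.
Qed.

End integral_density.

End density.

Section product_laws.
Local Open Scope ereal_scope.
Context d1 d2 (T1 : measurableType d1) (T2 : measurableType d2) (R : realType).

(** Rectangles are stable under intersection and generate the product sigma-algebra. Finiteness of
    [m setT] lets the constant sequence [setT] serve as exhaustion. *)
Lemma rectangle_measure_unique (m m' : {measure set (T1 * T2) -> \bar R}) :
  m setT < +oo ->
  (forall A B, measurable A -> measurable B -> m (A `*` B) = m' (A `*` B)) ->
  forall C, measurable C -> m C = m' C.
Proof.
move=> moo mm'.
apply: (measure_unique [set A `*` B | A in measurable & B in measurable]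
  (fun=> setT)) => //.
- exact: measurable_prod_measurableType.
- move=> _ _ [A mA [B mB <-]] [A' mA' [B' mB' <-]].
  exists (A `&` A'); first exact: measurableI.
  by exists (B `&` B'); [exact: measurableI|rewrite setXI].
- by move=> _; exists setT => //; exists setT => //; rewrite setXTT.
- by rewrite bigcup_const.
- by move=> _ [A mA [B mB <-]]; exact: mm'.
Qed.

Variables (m1 : {sigma_finite_measure set T1 -> \bar R})
  (m2 : {sigma_finite_measure set T2 -> \bar R}).

(** Bundles sigma-finiteness, so that a product can itself be a factor: the observations of three
    frames live in a product of one space with a product of two. *)
Definition sigma_finite_prod : {sigma_finite_measure set (T1 * T2)%type -> \bar R} :=
  HB.pack (m1 \x m2) (Measure_isSigmaFinite.Build _ _ _ (m1 \x m2)
    (product_measure_sigma_finite m1 m2)).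

Lemma integral_rectangle (f : T1 -> R) (g : T2 -> R) A B :
  measurable_fun setT f -> (forall x, (0 <= f x)%R) ->
  measurable_fun setT g -> (forall x, (0 <= g x)%R) ->
  measurable A -> measurable B ->
  \int[m1 \x m2]_(p in A `*` B) (f p.1 * g p.2)%:E =
  \int[m1]_(x in A) (f x)%:E * \int[m2]_(y in B) (g y)%:E.
Proof.
move=> mf f0 mg g0 mA mB.
pose F (p : T1 * T2) := (f p.1)%:E * (\1_A p.1)%:E * ((g p.2)%:E * (\1_B p.2)%:E).
have mfA : measurable_fun setT (fun x => (f x)%:E * (\1_A x)%:E).
  by apply: emeasurable_funM; apply/measurable_EFinP.
have mgB : measurable_fun setT (fun x => (g x)%:E * (\1_B x)%:E).
  by apply: emeasurable_funM; apply/measurable_EFinP.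
have f0A x : 0 <= (f x)%:E * (\1_A x)%:E by rewrite mule_ge0// lee_fin.
have g0B x : 0 <= (g x)%:E * (\1_B x)%:E by rewrite mule_ge0// lee_fin.
rewrite integral_mkcond epatch_indic.
transitivity (\int[m1 \x m2]_p F p).
  apply: eq_integral => p _; rewrite /F -!EFinM; congr EFin.
  by rewrite mulrACA !indicE in_setX -natrM mulnb.
rewrite fubini_tonelli1//; last 2 first.
- apply: emeasurable_funM.
    exact: (measurableT_comp mfA measurable_fst).
  exact: (measurableT_comp mgB measurable_snd).
- by move=> p; rewrite mule_ge0.
rewrite /fubini_F /F/=.
under eq_integral do rewrite ge0_integralZl//.
rewrite ge0_integralZr//; last exact: integral_ge0.
by rewrite (integral_mkcond A) (integral_mkcond B) !epatch_indic.
Qed.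

(** Both sides are measures in [C] that agree on rectangles. The constant [k] makes room for the
    probability of an event or for the contribution of other variables. *)
Lemma joint_density d (T : measurableType d) (Q : {measure set T -> \bar R})
    (X : T -> T1) (Y : T -> T2) (f : T1 -> R) (g : T2 -> R) (k : R) :
  measurable_fun setT X -> measurable_fun setT Y ->
  measurable_fun setT f -> (forall x, (0 <= f x)%R) ->
  measurable_fun setT g -> (forall x, (0 <= g x)%R) ->
  Q setT < +oo -> (0 <= k)%R ->
  (forall A B, measurable A -> measurable B ->
    Q (X @^-1` A `&` Y @^-1` B) =
    k%:E * (\int[m1]_(x in A) (f x)%:E * \int[m2]_(y in B) (g y)%:E)) ->
  forall C, measurable C ->
    Q ((fun w => (X w, Y w)) @^-1` C) =
    k%:E * \int[m1 \x m2]_(p in C) (f p.1 * g p.2)%:E.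
Proof.
move=> mX mY mf f0 mg g0 Qoo k0 QE C mC.
have mXY : measurable_fun setT (fun w => (X w, Y w)).
  exact: measurable_fun_pair.
pose XY : {mfun T >-> (T1 * T2)%type} := mfun_Sub (mem_set mXY).
have mfg : measurable_fun setT (fun p : T1 * T2 => (f p.1 * g p.2)%R).
  by apply: measurable_funM; exact: measurableT_comp.
have fg0 (p : T1 * T2) : (0 <= f p.1 * g p.2)%R by rewrite mulr_ge0.
apply: (@rectangle_measure_unique (pushforward Q XY)
  (mscale (NngNum k0) (mdensity (m1 \x m2) mfg fg0))) => // A B mA mB.
by rewrite /= /mscale/= /mdensity integral_rectangle// -QE.
Qed.

(** Intersecting with [D] is absorbed into the finite measure [mrestr P mD], to which the previous
    lemma applies. *)
Lemma joint_density_event d (T : measurableType d) (P : probability T R)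
    (D : set T) (X : T -> T1) (Y : T -> T2) (f : T1 -> R) (g : T2 -> R) (k : R) :
  measurable D -> measurable_fun setT X -> measurable_fun setT Y ->
  measurable_fun setT f -> (forall x, (0 <= f x)%R) ->
  measurable_fun setT g -> (forall x, (0 <= g x)%R) -> (0 <= k)%R ->
  (forall A B, measurable A -> measurable B ->
    P (D `&` (X @^-1` A `&` Y @^-1` B)) =
    k%:E * (\int[m1]_(x in A) (f x)%:E * \int[m2]_(y in B) (g y)%:E)) ->
  forall C, measurable C ->
    P (D `&` (fun w => (X w, Y w)) @^-1` C) =
    k%:E * \int[m1 \x m2]_(p in C) (f p.1 * g p.2)%:E.
Proof.
move=> mD mX mY mf f0 mg g0 k0 PE C mC; rewrite setIC.
apply: (joint_density (Q := mrestr P mD)) => // [|A B mA mB].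
  by rewrite /= /mrestr setTI -ge0_fin_numE// fin_num_measure.
by rewrite -PE//= /mrestr setIC.
Qed.

End product_laws.

Section product_change_of_variables.
Local Open Scope ereal_scope.
Context d1 d2 (T1 : measurableType d1) (T2 : measurableType d2) (R : realType).
Variables (m1 : {sigma_finite_measure set T1 -> \bar R})
  (m2 : {sigma_finite_measure set T2 -> \bar R}).

(** The change of variables formula for a map of constant Jacobian; [k] stands for the inverse of
    the absolute Jacobian determinant. *)
Definition scaled_by d (T : measurableType d) (m : set T -> \bar R)
    (phi : T -> T) (k : R) :=
  forall F : T -> \bar R, measurable_fun setT F -> (forall x, 0 <= F x) ->
    \int[m]_x F (phi x) = k%:E * \int[m]_x F x.

Lemma scaled_by_prod (phi1 : T1 -> T1) (phi2 : T2 -> T2) (k1 k2 : R) :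
  measurable_fun setT phi1 -> measurable_fun setT phi2 ->
  (0 <= k1)%R -> (0 <= k2)%R ->
  scaled_by m1 phi1 k1 -> scaled_by m2 phi2 k2 ->
  scaled_by (m1 \x m2) (fun p => (phi1 p.1, phi2 p.2)) (k1 * k2).
Proof.
move=> mphi1 mphi2 k10 k20 H1 H2 F mF F0.
have mphi : measurable_fun setT (fun p : T1 * T2 => (phi1 p.1, phi2 p.2)).
  by apply: measurable_fun_pair; exact: measurableT_comp.
have mG : measurable_fun setT (fubini_F m2 F).
  exact: measurable_fun_fubini_tonelli_F.
have G0 x : 0 <= fubini_F m2 F x by exact: integral_ge0.
rewrite fubini_tonelli1//; last exact: (measurableT_comp mF mphi).
transitivity (\int[m1]_x (k2%:E * fubini_F m2 F (phi1 x))).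
  apply: eq_integral => x _.
  rewrite /fubini_F/= (H2 (fun y => F (phi1 x, y)))//.
  by apply: (measurableT_comp mF); exact: measurable_pair1.
rewrite ge0_integralZl//; last exact: (measurableT_comp mG mphi1).
by rewrite (H1 (fubini_F m2 F))// fubini_tonelli1// muleA -EFinM mulrC.
Qed.

End product_change_of_variables.

(** * Affine changes of variables and complex Gaussian densities *)

Lemma measurable_fun_inv_pos d (T : measurableType d) (R : realType) (f : T -> R) :
  measurable_fun setT f -> (forall x, 0 < f x) ->
  measurable_fun setT (fun x => (f x)^-1).
Proof.
move=> mf f0; rewrite (_ : (fun _ => _) = fun x => f x `^ (-1)); last first.
  by apply/funext => x; rewrite powR_inv1// ltW.
exact: (measurableT_comp (measurable_powR (-1)) mf).
Qed.

Section measurable_cvec_operations.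
Context (R : realType) (d : measure_display) (T : measurableType d) (M : nat).
Implicit Types f g : T -> 'rV[R[i]]_M.

Lemma measurable_cvec_Re f j : measurable_fun setT f ->
  measurable_fun setT (fun w => complex.Re (f w 0 j)).
Proof.
move=> /measurable_fun_cvecP/(_ j) mf.
exact: (measurableT_comp measurable_fst mf).
Qed.

Lemma measurable_cvec_Im f j : measurable_fun setT f ->
  measurable_fun setT (fun w => complex.Im (f w 0 j)).
Proof.
move=> /measurable_fun_cvecP/(_ j) mf.
exact: (measurableT_comp measurable_snd mf).
Qed.

Lemma measurable_cvecD f g : measurable_fun setT f -> measurable_fun setT g ->
  measurable_fun setT (fun w => f w + g w).
Proof.
move=> mf mg; apply/measurable_fun_cvecP => j.
rewrite (_ : _ \o _ = fun w =>
    (complex.Re (f w 0 j) + complex.Re (g w 0 j),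
     complex.Im (f w 0 j) + complex.Im (g w 0 j))); last first.
  by apply/funext => w; rewrite /cvec_coor/= !mxE !raddfD.
by apply: measurable_fun_pair; apply: measurable_funD;
  solve [exact: measurable_cvec_Re|exact: measurable_cvec_Im].
Qed.

Lemma measurable_cvecZ (k : T -> R) f :
  measurable_fun setT k -> measurable_fun setT f ->
  measurable_fun setT (fun w => (k w)%:C *: f w).
Proof.
move=> mk mf; apply/measurable_fun_cvecP => j.
rewrite (_ : _ \o _ = fun w =>
    (k w * complex.Re (f w 0 j), k w * complex.Im (f w 0 j))); last first.
  apply/funext => w; rewrite /cvec_coor/= !mxE; case: (f w 0 j) => x y /=.
  by rewrite !mul0r subr0 addr0.
by apply: measurable_fun_pair; apply: measurable_funM => //;
  solve [exact: measurable_cvec_Re|exact: measurable_cvec_Im].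
Qed.

End measurable_cvec_operations.

Lemma measurable_sqnorm (R : realType) (M : nat) : measurable_fun setT (@sqnorm R M).
Proof.
rewrite /sqnorm; apply: measurable_sum => j.
apply: measurable_funD; apply: measurable_funX.
  by have := @measurable_cvec_Re R _ _ M id j (@measurable_id _ _ setT).
by have := @measurable_cvec_Im R _ _ M id j (@measurable_id _ _ setT).
Qed.

Lemma measurable_cvec_affine (R : realType) (M : nat) (a : R) (v : 'rV[R[i]]_M) :
  measurable_fun setT (fun x : 'rV[R[i]]_M => a%:C *: x + v).
Proof.
have ma := @measurable_cvecZ R _ _ M (cst a) id (@measurable_cst _ _ _ _ setT a)
  (@measurable_id _ _ setT).
by have := @measurable_cvecD R _ _ M _ (cst v) ma (@measurable_cst _ _ _ _ setT v).
Qed.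

Section affine_change_of_variables.
Local Open Scope ereal_scope.
Context (R : realType).

(** Uniqueness of Lebesgue measure: [a] times its image under the affine map gives every half-open
    interval its length. *)
Let lebesgue_scaled_by_affine_pos (a b : R) : (0 < a)%R ->
  scaled_by (@lebesgue_measure R) (fun x => a * x + b)%R a^-1.
Proof.
move=> a0 F mF F0.
have mphi : @measurable_fun _ _ (measurableTypeR R) (measurableTypeR R) setT
    (fun x => a * x + b)%R.
  by apply: measurable_funD => //; exact: measurable_funM.
pose phi : {mfun measurableTypeR R >-> measurableTypeR R} :=
  @mfun_Sub _ _ (measurableTypeR R) (measurableTypeR R) _ (mem_set mphi).
have aE A : measurable A ->
    lebesgue_measure A = mscale (NngNum (ltW a0)) (pushforward lebesgue_measure phi) A.
  apply: (@lebesgue_measure_unique _ (mscale (NngNum (ltW a0))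
    (pushforward (@lebesgue_measure R) phi))) => _ [[u v] _ <-].
  rewrite /= /mscale/= /pushforward.
  have -> : phi @^-1` `]u, v]%classic = `](u - b) / a, (v - b) / a]%classic%R.
    apply/seteqP; split=> x /=; rewrite !in_itv/= ltr_pdivrMr// ler_pdivlMr//;
    by rewrite ltrBlDr lerBrDr mulrC.
  rewrite !lebesgue_measure_itv/= !lte_fin ltr_pM2r ?invr_gt0// ltrD2r.
  case: ifPn => _; last by rewrite mule0.
  rewrite -!EFinD -EFinM; congr EFin; field.
  by rewrite gt_eqF.
transitivity (\int[pushforward lebesgue_measure phi]_x F x).
  by rewrite ge0_integral_pushforward.
rewrite [in RHS](eq_measure_integral (mscale (NngNum (ltW a0))
    (pushforward (@lebesgue_measure R) phi))); last first.
  by move=> A mA _; exact: aE.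
rewrite ge0_integral_mscale//= muleA -EFinM mulVf ?mul1e//.
by rewrite gt_eqF.
Qed.

(** A negative slope is reduced to a positive one by the reflection [x -> - x], which preserves
    Lebesgue measure. *)
Lemma lebesgue_scaled_by_affine (a b : R) : a != 0%R ->
  scaled_by (@lebesgue_measure R) (fun x => a * x + b)%R `|a|^-1.
Proof.
move=> a0 F mF F0; have [ap|an] := ltP 0%R a.
  by rewrite gtr0_norm//; exact: lebesgue_scaled_by_affine_pos.
have {an}an : (0 < - a)%R by rewrite oppr_gt0 lt_neqAle a0.
rewrite ltr0_norm -?oppr_gt0//.
rewrite -(lebesgue_scaled_by_affine_pos b an mF F0).
have maff : @measurable_fun _ _ (measurableTypeR R) (measurableTypeR R) setT
    (fun x => - a * x + b)%R.
  by apply: measurable_funD => //; exact: measurable_funM.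
have mG := measurableT_comp mF maff.
transitivity (\int[pushforward (@lebesgue_measure R)
    (-%R : _ -> measurableTypeR R)]_x F (- a * x + b)%R).
  rewrite ge0_integral_pushforward//.
  by apply: eq_integral => x _ /=; rewrite mulrNN.
by apply: eq_measure_integral => A mA _; exact: lebesgue_measureN.
Qed.

Lemma cvec_cons_affine M (a : R) (p : R * R) (z : 'rV[R[i]]_M)
    (v : 'rV[R[i]]_(1 + M)) :
  (a%:C *: cvec_cons (p, z) + v = cvec_cons
    ((a * p.1 + (cvec_uncons v).1.1, a * p.2 + (cvec_uncons v).1.2),
     a%:C *: z + (cvec_uncons v).2))%R.
Proof.
apply/rowP => j; rewrite /cvec_cons /cvec_uncons /cvec_coor 2!mxE.
case: (split_ordP j) => k ->; last by rewrite !row_mxEr !mxE.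
rewrite !row_mxEl !mxE ord1/=; case: (v _ _) => x y; apply/eqP.
by rewrite eq_complex/= !mul0r subr0 addr0 !eqxx.
Qed.

(** A complex coordinate consists of two real ones, each contributing [|a|^-1], hence [a ^- 2] per
    coordinate. The induction follows the recursive construction of the measure and starts from the
    one-point space of empty vectors. *)
Lemma cvec_lebesgue_scaled_by_affine M (a : R) (v : 'rV[R[i]]_M) : a != 0%R ->
  scaled_by (cvec_lebesgue R M) (fun x => a%:C *: x + v)%R ((a ^- 2) ^+ M).
Proof.
move=> a0; elim: M v => [|M IH] v F mF F0.
  rewrite expr0 mul1e; apply: eq_integral => x _; congr F.
  by apply/matrixP => i [].
have mcons := @measurable_cvec_cons R M.
have mphi : measurable_fun setT (fun x : 'rV[R[i]]_M.+1 => a%:C *: x + v)%R.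
  exact: measurable_cvec_affine.
rewrite /= ge0_integral_pushforward//; last exact: (measurableT_comp mF mphi).
rewrite ge0_integral_pushforward// !preimage_setT/=.
pose w := @cvec_uncons R M v.
pose aff b x := (a * x + b)%R.
have maff b : @measurable_fun _ _ (measurableTypeR R) (measurableTypeR R) setT (aff b).
  by apply: measurable_funD => //; exact: measurable_funM.
have aV0 : (0 <= `|a|^-1)%R by rewrite invr_ge0.
have aV20 : (0 <= (a ^- 2) ^+ M)%R by rewrite exprn_ge0// invr_ge0 sqr_ge0.
have plane : scaled_by (@plane_lebesgue R)
    (fun p => (aff w.1.1 p.1, aff w.1.2 p.2)) (`|a|^-1 * `|a|^-1)%R.
  by apply: scaled_by_prod => //; exact: lebesgue_scaled_by_affine.
have mplane : measurable_fun setT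
    (fun p : measurableTypeR R * measurableTypeR R =>
       (aff w.1.1 p.1, aff w.1.2 p.2)).
  apply: measurable_fun_pair.
    exact: (measurableT_comp (maff w.1.1) measurable_fst).
  exact: (measurableT_comp (maff w.1.2) measurable_snd).
have mIH : measurable_fun setT (fun x : 'rV[R[i]]_M => a%:C *: x + w.2)%R.
  exact: measurable_cvec_affine.
have := @scaled_by_prod _ _ _ _ _ _ (cvec_lebesgue R M) _ _ _ _ mplane mIH
  (mulr_ge0 aV0 aV0) aV20 plane (IH w.2) (F \o @cvec_cons R M).
move=> /(_ (measurableT_comp mF mcons) (fun=> F0 _)).
have -> : ((a ^- 2) ^+ M.+1 = `|a|^-1 * `|a|^-1 * (a ^- 2) ^+ M)%R.
  by rewrite exprS -invfM -expr2 real_normK// num_real.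
move=> <-.
by apply: eq_integral => -[p z] _ /=; rewrite cvec_cons_affine.
Qed.

End affine_change_of_variables.

Section cnormal_density.
Context (R : realType) (M : nat).
Implicit Types (x y v : 'rV[R[i]]_M) (a b e sigma : R).

Lemma sqnormZ a x : sqnorm (a%:C *: x) = a ^+ 2 * sqnorm x.
Proof.
rewrite /sqnorm mulr_sumr; apply: eq_bigr => j _; rewrite mxE.
by case: (x 0 j) => u w /=; ring.
Qed.

Lemma sqnorm_ge0 x : 0 <= sqnorm x.
Proof. by apply: sumr_ge0 => j _; rewrite addr_ge0// sqr_ge0. Qed.

Lemma cnormal_pdf_gt0 sigma x : 0 < sigma -> 0 < cnormal_pdf sigma x.
Proof.
by move=> s0; rewrite mulr_gt0 ?expR_gt0// invr_gt0 exprn_gt0// mulr_gt0// pi_gt0.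
Qed.

Lemma cnormal_pdf_ge0 sigma x : 0 < sigma -> 0 <= cnormal_pdf sigma x.
Proof. by move=> s0; exact/ltW/cnormal_pdf_gt0. Qed.

Lemma measurable_cnormal_pdf sigma :
  measurable_fun setT (cnormal_pdf sigma : 'rV[R[i]]_M -> R).
Proof.
apply: measurable_funM => //; apply: measurableT_comp => //.
apply: measurableT_comp => //; apply: measurable_funM => //.
exact: measurable_sqnorm.
Qed.

Lemma cnormal_pdfZ a sigma x : a != 0 ->
  cnormal_pdf (a ^+ 2 * sigma) (a%:C *: x) = (a ^- 2) ^+ M * cnormal_pdf sigma x.
Proof.
move=> a0; rewrite /cnormal_pdf sqnormZ [RHS]mulrA; congr (_ * expR (- _)).
  by rewrite mulrCA exprMn invfM exprVn.
by rewrite invfM mulrACA divff ?mul1r// expf_neq0.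
Qed.

(* Bayes' rule for the sum of two independent Gaussians: given [y = h + n], [h] is
   Gaussian with mean [b / (b + e) * y] and variance [b * e / (b + e)]. *)
Lemma cnormal_pdf_bayes b e x y : 0 < b -> 0 < e ->
  cnormal_pdf b x * cnormal_pdf e (y - x) =
  cnormal_pdf (b + e) y *
  cnormal_pdf (b * e / (b + e)) (x - (b / (b + e))%:C *: y).
Proof.
move=> b0 e0; have be0 : b + e != 0 by rewrite gt_eqF// addr_gt0.
have p0 : pi != 0 :> R by rewrite gt_eqF// pi_gt0.
rewrite /cnormal_pdf [LHS]mulrACA [RHS]mulrACA -!expRD -!invfM -!exprMn -!opprD.
congr (_ ^- _ * expR (- _)).
  by field.
rewrite /sqnorm !mulr_suml -!big_split; apply: eq_bigr => j _; rewrite !mxE.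
case: (x 0 j) => x1 x2; case: (y 0 j) => y1 y2 /=.
by field; rewrite be0 !gt_eqF.
Qed.

Lemma upsilon_gt0 b e x : 0 < b -> 0 < e -> 0 < upsilon b e x.
Proof.
by move=> b0 e0; rewrite mulr_gt0 ?expR_gt0// exprn_gt0// divr_gt0// addr_gt0.
Qed.

Lemma measurable_upsilon b e :
  measurable_fun setT (upsilon b e : 'rV[R[i]]_M -> R).
Proof.
apply: measurable_funM => //; apply: measurableT_comp => //.
apply: measurableT_comp => //; apply: measurable_funM => //.
exact: measurable_sqnorm.
Qed.

(** An observation has variance [e] when the device is inactive and [b + e] when it is active, so
    this is what makes [upsilon] an inverse likelihood ratio. *)
Lemma cnormal_pdf_upsilon b e x : 0 < b -> 0 < e ->
  cnormal_pdf e x = upsilon b e x * cnormal_pdf (b + e) x.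
Proof.
move=> b0 e0; have be0 : b + e != 0 by rewrite gt_eqF// addr_gt0.
have p0 : pi != 0 :> R by rewrite gt_eqF// pi_gt0.
rewrite /cnormal_pdf /upsilon mulrACA -expRD; congr (_ * expR _).
  rewrite -!exprVn -exprMn; congr (_ ^+ _).
  by move: (pi : R) p0 => p p0; field; rewrite be0 p0 gt_eqF.
by rewrite [e + b]addrC; field; rewrite be0 gt_eqF.
Qed.

Lemma integral_cvec_lebesgue_shift (F : 'rV[R[i]]_M -> \bar R) v :
  measurable_fun setT F -> (forall x, (0 <= F x)%E) ->
  (\int[cvec_lebesgue R M]_x F (x + v)%R = \int[cvec_lebesgue R M]_x F x)%E.
Proof.
move=> mF F0; have := @cvec_lebesgue_scaled_by_affine R M 1 v (oner_neq0 R) F mF F0.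
rewrite expr1n invr1 expr1n mul1e => <-.
by apply: eq_integral => x _; rewrite scale1r.
Qed.

(** The factor [k] by which the density changes under scaling equals the inverse Jacobian of the
    scaling, and the two cancel. *)
Lemma integral_cnormal_pdfZ a sigma (A : set 'rV[R[i]]_M) : a != 0 -> 0 < sigma ->
  measurable A ->
  (\int[cvec_lebesgue R M]_(x in (fun x => a%:C *: x)%R @^-1` A)
     (cnormal_pdf sigma x)%:E =
   \int[cvec_lebesgue R M]_(x in A) (cnormal_pdf (a ^+ 2 * sigma) x)%:E)%E.
Proof.
move=> a0 s0 mA.
have a20 : 0 < a ^+ 2 by rewrite exprn_even_gt0.
have as0 : 0 < a ^+ 2 * sigma by rewrite mulr_gt0.
pose G x := ((cnormal_pdf (a ^+ 2 * sigma) x)%:E * (\1_A x)%:E)%E.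
have mG : measurable_fun setT G.
  apply: emeasurable_funM; apply/measurable_EFinP => //.
  exact: measurable_cnormal_pdf.
have G0 x : (0 <= G x)%E by rewrite mule_ge0// lee_fin cnormal_pdf_ge0.
pose k : R := (a ^- 2) ^+ M.
have k0 : 0 < k by rewrite exprn_gt0// invr_gt0.
have mkG : measurable_fun setT (fun x => (k^-1)%:E * G x)%E.
  exact: emeasurable_funM.
have kG0 x : (0 <= (k^-1)%:E * G x)%E by rewrite mule_ge0// lee_fin invr_ge0 ltW.
rewrite integral_mkcond epatch_indic [RHS]integral_mkcond epatch_indic.
transitivity (\int[cvec_lebesgue R M]_x ((k^-1)%:E * G (a%:C *: x + 0)%R))%E.
  apply: eq_integral => x _; rewrite /G addr0 cnormal_pdfZ// -/k -!EFinM; congr EFin.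
  by rewrite mulrA mulKf ?gt_eqF.
rewrite (@cvec_lebesgue_scaled_by_affine R M a 0 a0 _ mkG kG0).
rewrite ge0_integralZl// ?lee_fin ?invr_ge0 ?(ltW k0)//.
by rewrite muleA -EFinM divff ?gt_eqF// mul1e.
Qed.

Lemma measurable_cvec_preimageZ a (A : set 'rV[R[i]]_M) :
  measurable A -> measurable ((fun x => a%:C *: x) @^-1` A).
Proof.
move=> mA; rewrite (_ : (fun _ => _) = fun x => a%:C *: x + 0); last first.
  by apply/funext => x; rewrite addr0.
by rewrite -[X in measurable X]setTI; exact: measurable_cvec_affine.
Qed.

Let lam := cvec_lebesgue R M.

(** For independent [h] and [n] of variances [b] and [e], this is the independence of
    [h - c (h + n)] and [h + n], with their two variances. It follows from Bayes' rule for the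
    densities and two translations. *)
Lemma integral_cnormal_sum b e (A B : set 'rV[R[i]]_M) : 0 < b -> 0 < e ->
  measurable A -> measurable B ->
  (\int[lam \x lam]_(p in (fun p => (p.1 - (b / (b + e))%:C *: (p.1 + p.2))%R) @^-1` A
                        `&` (fun p => (p.1 + p.2)%R) @^-1` B)
     (cnormal_pdf b p.1 * cnormal_pdf e p.2)%:E =
   \int[lam]_(x in A) (cnormal_pdf (b * e / (b + e)) x)%:E *
   \int[lam]_(y in B) (cnormal_pdf (b + e) y)%:E)%E.
Proof.
move=> b0 e0 mA mB.
set c := b / (b + e); set s := b * e / (b + e).
have be0 : 0 < b + e by rewrite addr_gt0.
have s0 : 0 < s by rewrite divr_gt0// mulr_gt0.
have mf sigma := @measurable_cnormal_pdf sigma.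
have msum : measurable_fun setT
    (fun p : 'rV[R[i]]_M * 'rV[R[i]]_M => p.1 + p.2).
  exact: measurable_cvecD.
have mlin : measurable_fun setT
    (fun p : 'rV[R[i]]_M * 'rV[R[i]]_M => p.1 - c%:C *: p.2).
  rewrite (_ : (fun _ => _) = fun p => p.1 + (- c)%:C *: p.2).
    by apply: measurable_cvecD => //; exact: (@measurable_cvecZ _ _ _ _ (cst _)).
  by apply/funext => p; rewrite rmorphN scaleNr.
pose K y := ((cnormal_pdf s y)%:E * (\1_A y)%:E)%E.
pose L y := ((cnormal_pdf (b + e) y)%:E * (\1_B y)%:E)%E.
have mK : measurable_fun setT K.
  by apply: emeasurable_funM; apply/measurable_EFinP.
have mL : measurable_fun setT L.
  by apply: emeasurable_funM; apply/measurable_EFinP.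
have K0 y : (0 <= K y)%E by rewrite mule_ge0// lee_fin cnormal_pdf_ge0.
have L0 y : (0 <= L y)%E by rewrite mule_ge0// lee_fin cnormal_pdf_ge0.
(* [H] is the integrand in the coordinates (channel, observation), [G] below the same integrand in
   the coordinates (channel, noise). *)
pose H (p : 'rV[R[i]]_M * 'rV[R[i]]_M) := (K (p.1 - c%:C *: p.2)%R * L p.2)%E.
have mH : measurable_fun setT H.
  apply: emeasurable_funM; last exact: (measurableT_comp mL).
  exact: (measurableT_comp mK mlin).
have H0 p : (0 <= H p)%E by rewrite mule_ge0.
pose G (p : 'rV[R[i]]_M * 'rV[R[i]]_M) := H (p.1, p.1 + p.2).
have mG : measurable_fun setT G.
  by apply: (measurableT_comp mH); exact: measurable_fun_pair.
rewrite integral_mkcond epatch_indic.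
transitivity (\int[lam \x lam]_p G p)%E.
  apply: eq_integral => p _; rewrite /G /H /K /L/= -!EFinM; congr EFin.
  have -> : cnormal_pdf e p.2 = cnormal_pdf e (p.1 + p.2 - p.1).
    by rewrite addrAC subrr add0r.
  rewrite cnormal_pdf_bayes// !indicE in_setI -mulnb natrM.
  by rewrite [cnormal_pdf _ _ * cnormal_pdf _ _]mulrC mulrACA.
rewrite fubini_tonelli1//; last by move=> p; exact: H0.
(* At a fixed channel, passing from the noise to the observation is a translation. The order of
   integration is then exchanged, so that at a fixed observation the channel can be translated by
   [c] times it. *)
transitivity (\int[lam]_x \int[lam]_y H (x, y))%E.
  apply: eq_integral => x _; rewrite /fubini_F /G/=.
  under eq_integral do rewrite addrC.
  rewrite (integral_cvec_lebesgue_shift (F := fun y => H (x, y)))//.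
  by apply: (measurableT_comp mH); exact: measurable_pair1.
rewrite fubini_tonelli//.
transitivity (\int[lam]_y (\int[lam]_x K x * L y))%E.
  apply: eq_integral => y _; rewrite /H/= ge0_integralZr//.
    by rewrite (integral_cvec_lebesgue_shift (F := K)).
  apply: (measurableT_comp mK).
  exact: (measurableT_comp mlin (measurable_pair2 y)).
rewrite ge0_integralZl//; last exact: integral_ge0.
by rewrite (integral_mkcond A) (integral_mkcond B) !epatch_indic.
Qed.

End cnormal_density.

(** * The activity chain *)

Section activity.
Context (R : realType) (d : measure_display) (T : measurableType d).
Variable P : probability T R.
Variables (l : nat -> {RV P >-> bool}) (p01 p11 pa : R).
Hypothesis chain_l : activity_chain l p01 p11 pa.
Hypotheses (pa_gt0 : 0 < pa) (pa_lt1 : pa < 1).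

Definition transition (a c : bool) : R :=
  let p := if a then p11 else p01 in if c then p else 1 - p.

Definition activity_prob (a : bool) : R := if a then pa else 1 - pa.

Lemma activity_prob_gt0 a : 0 < activity_prob a.
Proof. by case: a => //=; rewrite subr_gt0. Qed.

Lemma measurable_activity tau a : measurable (l tau @^-1` [set a]).
Proof. by rewrite -[X in measurable X]setTI; exact: measurable_funP. Qed.

Lemma measure_activity_split tau A : measurable A ->
  P A = (P (A `&` l tau @^-1` [set true]) + P (A `&` l tau @^-1` [set false]))%E.
Proof.
move=> mA; rewrite -measureU.
- rewrite -setIUr; congr (P _); rewrite -[LHS]setIT; congr (_ `&` _).
  by apply/seteqP; split => w //= _; case: (l tau w); [left|right].
- exact: measurableI (measurable_activity tau true).
- exact: measurableI (measurable_activity tau false).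
- by apply/seteqP; split => w //= -[[_ ->]] [].
Qed.

Let eq_addEFinl (x y : R) (z : \bar R) : x%:E = (y%:E + z)%E -> z = (x - y)%:E.
Proof. by case: z => [z| |]//; rewrite -EFinD => -[->]; congr EFin; ring. Qed.

Lemma measure_activity tau a : P (l tau @^-1` [set a]) = (activity_prob a)%:E.
Proof.
case: a; first exact: activity_pa chain_l tau.
have := @measure_activity_split tau setT measurableT.
rewrite probability_setT setTI (activity_pa chain_l) => /eq_addEFinl.
by rewrite setTI.
Qed.

Lemma measure_activity2 tau a c :
  P (l tau @^-1` [set a] `&` l tau.+1 @^-1` [set c]) =
  (activity_prob a * transition a c)%:E.
Proof.
have Ht : P (l tau @^-1` [set a] `&` l tau.+1 @^-1` [set true]) =
    (activity_prob a * transition a true)%:E.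
  have : cond_prob P (l tau.+1 @^-1` [set true]) (l tau @^-1` [set a]) =
      transition a true.
    by case: (a); [exact: (activity_p11 chain_l)|exact: (activity_p01 chain_l)].
  rewrite /cond_prob measure_activity/= => <-.
  rewrite mulrCA divff ?mulr1 ?gt_eqF ?activity_prob_gt0//.
  rewrite [X in fine (P X)]setIC fineK//; apply: fin_num_measure.
  by apply: measurableI; exact: measurable_activity.
case: c => //.
have := measure_activity_split tau.+1 (measurable_activity tau a).
rewrite measure_activity Ht => /eq_addEFinl ->.
by rewrite /transition; congr EFin; ring.
Qed.

(** With two states, stationarity alone forces reversibility: equal laws at frames 0 and 1 mean that
    the flow from inactive to active equals the flow back. *)
Lemma activity_balance a c :
  activity_prob a * transition a c = activity_prob c * transition c a.
Proof.
have := measure_activity_split 0 (measurable_activity 1 true).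
rewrite ![l 1 @^-1` _ `&` _]setIC !measure_activity2 measure_activity -EFinD.
by case; case: a; case: c => //=; lra.
Qed.

(** No bounds on [p01] and [p11] are assumed; they follow because [activity_prob a * transition a c]
    is a probability and its first factor is positive. *)
Lemma transition_ge0 a c : 0 <= transition a c.
Proof.
by rewrite -(pmulr_rge0 _ (activity_prob_gt0 a)) -lee_fin -(measure_activity2 0).
Qed.

(** The product is centred at the middle frame: given the target activity, the two neighbours are
    independent and, by reversibility, follow the same kernel. Hence the two similar factors in
    [phi]. *)
Lemma measure_activity3 tau a0 a1 a2 :
  P (l tau @^-1` [set a0] `&` l tau.+1 @^-1` [set a1]
     `&` l tau.+2 @^-1` [set a2]) =
  (activity_prob a1 * transition a1 a0 * transition a1 a2)%:E.
Proof.
have mA k c := measurable_activity k c.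
pose b := nth false [:: a0; a1; a2].
have bigcapS s n : \bigcap_(k in `I_n.+1) (l (s + k)%N @^-1` [set b k]) =
    \bigcap_(k in `I_n) (l (s + k)%N @^-1` [set b k]) `&`
      l (s + n)%N @^-1` [set b n].
  by rewrite IIS bigcap_setU bigcap_set1.
have bigcap0 s : \bigcap_(k in `I_0) (l (s + k)%N @^-1` [set b k]) = setT.
  by rewrite II0 bigcap_set0.
have past : \bigcap_(k in `I_2) (l k @^-1` [set b k]) =
    l 0 @^-1` [set a0] `&` l 1 @^-1` [set a1].
  by have := bigcapS 0 1; rewrite (bigcapS 0 0) bigcap0 setTI => ->.
(* The Markov property conditions on the whole past since frame 0. Stationarity moves the three
   frames to 0, 1 and 2, where that past consists of just the first two. *)
have := activity_stationary chain_l tau 3 b.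
rewrite !bigcapS bigcap0 setTI addn0 addn1 addn2 => ->.
have := bigcapS 0 2; rewrite past => ->.
have -> : activity_prob a1 * transition a1 a0 = activity_prob a0 * transition a0 a1.
  exact: activity_balance.
(* The Markov property is silent on a null past; there both sides vanish. *)
have [p0|p0] := eqVneq (P (l 0 @^-1` [set a0] `&` l 1 @^-1` [set a1])) 0%E.
  have -> : activity_prob a0 * transition a0 a1 = 0.
    by apply: EFin_inj; rewrite -(measure_activity2 0).
  rewrite mul0r; apply/eqP; rewrite -measure_le0 -p0.
  apply: le_measure; rewrite ?inE; last exact: subIsetl.
    by apply: measurableI => //; exact: measurableI.
  exact: measurableI.
have := @activity_markov _ _ _ _ _ _ _ _ chain_l 1 b a2.
rewrite /= past => /(_ p0).
rewrite /cond_prob measure_activity2 measure_activity.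
rewrite [X in _ = fine (P X) / _]setIC measure_activity2/=.
rewrite [RHS]mulrAC divff ?gt_eqF ?activity_prob_gt0// mul1r => H.
have k0 : activity_prob a0 * transition a0 a1 != 0.
  by move: p0; rewrite measure_activity2; apply: contra_neq => ->.
rewrite setIC -[LHS]fineK; last first.
  by apply: fin_num_measure; apply: measurableI => //; exact: measurableI.
by congr EFin; rewrite -[transition a1 a2]H mulrC divfK.
Qed.

End activity.

(** * Laws of independent Gaussian vectors *)

Section complex_normal_laws.
Context (R : realType) (d : measure_display) (T : measurableType d).
Context (P : probability T R) (M : nat).
Implicit Types (X Y : T -> 'rV[R[i]]_M).

Let lam := cvec_lebesgue R M.

Lemma has_cnormal_lawZ (a sigma : R) X : a != 0 -> 0 < sigma ->
  has_cnormal_law P X sigma ->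
  has_cnormal_law P (fun w => a%:C *: X w) (a ^+ 2 * sigma).
Proof.
move=> a0 s0 lawX A mA; rewrite -integral_cnormal_pdfZ//.
by rewrite -lawX//; exact: measurable_cvec_preimageZ.
Qed.

(** Some vector has the Gaussian law of variance [a]; rescaled by the square root of [sigma / a] it
    has variance [sigma], so the integral is the total probability. *)
Lemma integral_cnormal_pdf (a sigma : R) X : 0 < a -> 0 < sigma ->
  has_cnormal_law P X a ->
  (\int[lam]_x (cnormal_pdf sigma x)%:E = 1)%E.
Proof.
move=> a0 s0 lawX.
have q0 : Num.sqrt (sigma / a) != 0 by rewrite sqrtr_eq0 -ltNge divr_gt0.
have /(_ setT measurableT) := has_cnormal_lawZ q0 a0 lawX.
rewrite sqr_sqrtr ?ltW ?divr_gt0// divfK ?gt_eqF// => <-.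
by rewrite preimage_setT probability_setT.
Qed.

End complex_normal_laws.

Section independence.
Context (R : realType) (d : measure_display) (T : measurableType d).
Context (P : probability T R) (M : nat).
Notation V := 'rV[R[i]]_M.

Let lam := cvec_lebesgue R M.

(** Induction on the number of pairs, with [E] universally quantified: this lets events about some
    pairs be moved into [E] while the others are treated. *)
Lemma independent_pairs (X Y : nat -> T -> V) (b : R) (e : nat -> R) n :
  (forall sigma, (0 < sigma)%R -> \int[lam]_x (cnormal_pdf sigma x)%:E = 1)%E ->
  (forall k, (k < n)%N -> measurable_fun setT (X k)) ->
  (forall k, (k < n)%N -> measurable_fun setT (Y k)) ->
  0 < b -> (forall k, (k < n)%N -> 0 < e k) ->
  forall E, measurable E ->
  (forall A B : nat -> set V, (forall k, measurable (A k)) ->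
    (forall k, measurable (B k)) ->
    (P (E `&` \bigcap_(k in `I_n) (X k @^-1` A k `&` Y k @^-1` B k)) =
    P E * \prod_(k < n) (\int[lam]_(x in A k) (cnormal_pdf b x)%:E *
                         \int[lam]_(y in B k) (cnormal_pdf (e k) y)%:E))%E) ->
  forall C : nat -> set (V * V), (forall k, measurable (C k)) ->
    (P (E `&` \bigcap_(k in `I_n) ((fun w => (X k w, Y k w)) @^-1` C k)) =
    P E * \prod_(k < n) \int[lam \x lam]_(p in C k)
      (cnormal_pdf b p.1 * cnormal_pdf (e k) p.2)%:E)%E.
Proof.
move=> mass1 mX mY b0 e0; elim: n mX mY e0 => [|n IH] mX mY e0 E mE HE C mC.
  by rewrite II0 !bigcap_set0 big_ord0 setIT mule1.
have mX' k : (k < n)%N -> measurable_fun setT (X k) by move=> kn; exact/mX/ltnW.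
have mY' k : (k < n)%N -> measurable_fun setT (Y k) by move=> kn; exact/mY/ltnW.
have e0' k : (k < n)%N -> 0 < e k by move=> kn; exact/e0/ltnW.
have mXn : measurable_fun setT (X n) by exact: mX.
have mYn : measurable_fun setT (Y n) by exact: mY.
have mpre (Z : T -> V) A : measurable_fun setT Z -> measurable A ->
  measurable (Z @^-1` A) by move=> mZ mA; rewrite -[X in measurable X]setTI; exact: mZ.
set D := \bigcap_(k in `I_n) ((fun w => (X k w, Y k w)) @^-1` C k).
have mD : measurable (E `&` D).
  apply: measurableI => //; apply: fin_bigcap_measurable => // k kn.
  rewrite -[X in measurable X]setTI; apply: measurable_fun_pair => //.
  - exact: mX'.
  - exact: mY'.
have mrect A B : measurable A -> measurable B ->
    measurable (X n @^-1` A `&` Y n @^-1` B).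
  by move=> mA mB; apply: measurableI; exact: mpre.
pose N (A B : set V) := (\int[lam]_(x in A) (cnormal_pdf b x)%:E *
                         \int[lam]_(y in B) (cnormal_pdf (e n) y)%:E)%E.
have NT : N setT setT = 1%E by rewrite /N !mass1 ?mule1// e0.
have rectE A B A' B' : measurable A' -> measurable B' ->
    (forall k, measurable (A k)) -> (forall k, measurable (B k)) ->
    (P (E `&` (X n @^-1` A' `&` Y n @^-1` B') `&`
        \bigcap_(k in `I_n) (X k @^-1` A k `&` Y k @^-1` B k)) =
     P E * N A' B' *
     \prod_(k < n) (\int[lam]_(x in A k) (cnormal_pdf b x)%:E *
                    \int[lam]_(y in B k) (cnormal_pdf (e k) y)%:E))%E.
  move=> mA' mB' mA mB.
  have := HE (fun k => if k == n then A' else A k)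
    (fun k => if k == n then B' else B k).
  rewrite IIS bigcap_setU bigcap_set1 eqxx big_ord_recr/= eqxx -/(N A' B').
  rewrite -setIA [X in _ `&` X]setIC -muleA [X in (_ * X)%E]muleC => H.
  rewrite (eq_bigcapr (G := fun k => X k @^-1` (if k == n then A' else A k) `&`
    Y k @^-1` (if k == n then B' else B k))); last first.
    by move=> k /= kn; rewrite ltn_eqF.
  rewrite H; last 2 first.
  - by move=> k; case: ifP.
  - by move=> k; case: ifP.
  by congr (_ * (_ * _))%E; apply: eq_bigr => k _; rewrite ltn_eqF.
(* Taking [setT], of Gaussian mass one, for the earlier pairs leaves the law of the last pair on
   [E]. *)
have rect1 A' B' : measurable A' -> measurable B' ->
    P (E `&` (X n @^-1` A' `&` Y n @^-1` B')) = (P E * N A' B')%E.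
  move=> mA' mB'; have := rectE (fun=> setT) (fun=> setT) A' B' mA' mB'
    (fun=> measurableT) (fun=> measurableT).
  rewrite big1 ?mule1 => [<-|k _]; last by rewrite !mass1 ?mule1 ?e0'.
  by congr (P _); apply/seteqP; split => [w ?|w []].
(* The induction hypothesis is used with the rectangle of the last pair added to [E]; [rectE] and
   [rect1] give the product formula it requires. *)
have key A B : measurable A -> measurable B ->
    (P (E `&` D `&` (X n @^-1` A `&` Y n @^-1` B)) =
     P E * N A B * \prod_(k < n) \int[lam \x lam]_(p in C k)
      (cnormal_pdf b p.1 * cnormal_pdf (e k) p.2)%:E)%E.
  move=> mA mB; rewrite setIAC /D IH//.
  - by rewrite rect1.
  - by apply: measurableI => //; exact: mrect.
  - by move=> A' B' mA' mB'; rewrite rectE// rect1.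
have PED : P (E `&` D) = (P E * \prod_(k < n) \int[lam \x lam]_(p in C k)
      (cnormal_pdf b p.1 * cnormal_pdf (e k) p.2)%:E)%E.
  have := key setT setT measurableT measurableT.
  by rewrite NT mule1 !preimage_setT !setIT.
have pdf0 s : 0 < s -> forall x : V, 0 <= cnormal_pdf s x.
  by move=> s0 x; exact: cnormal_pdf_ge0.
have PEDfin : P (E `&` D) \is a fin_num by exact: fin_num_measure.
have k0 : 0 <= fine (P (E `&` D)) by rewrite fine_ge0.
(* Conversely, the earlier pairs now belong to the event [E ∩ D], and only the last pair is left to
   extend from rectangles to [C n]. *)
rewrite IIS bigcap_setU bigcap_set1 -/D setIA big_ord_recr/= muleA -PED -(fineK PEDfin).
apply: joint_density_event => //; try exact: measurable_cnormal_pdf.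
- exact: pdf0.
- by apply: pdf0; exact: e0.
- by move=> A B mA mB; rewrite key// fineK// PED -/(N A B) muleAC.
Qed.

End independence.

(** * Transfer of integrals to the space of values *)

Section transfer.
Context d d' (T : measurableType d) (U : measurableType d') (R : realType).
Variables (P : {measure set T -> \bar R}) (rho : {measure set U -> \bar R}).
Variables (E : set T) (Z : T -> U) (F : U -> R).
Hypotheses (mE : measurable E) (mZ : measurable_fun setT Z).
Hypotheses (mF : measurable_fun setT F) (F0 : forall y, 0 <= F y).
Hypothesis densityE : forall C, measurable C ->
  P (E `&` Z @^-1` C) = (\int[rho]_(y in C) (F y)%:E)%E.

Let mpre C : measurable C -> measurable (Z @^-1` C).
Proof. by move=> mC; rewrite -[X in measurable X]setTI; exact: mZ. Qed.

Lemma ge0_integral_transfer (C : set U) (g : U -> \bar R) : measurable C ->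
  measurable_fun setT g -> (forall y, 0 <= g y)%E ->
  (\int[P]_(w in E `&` Z @^-1` C) g (Z w) = \int[rho]_(y in C) (g y * (F y)%:E))%E.
Proof.
move=> mC mg g0; pose Zm : {mfun T >-> U} := mfun_Sub (mem_set mZ).
rewrite -(@ge0_integral_density _ _ _ (pushforward (mrestr P mE) Zm))//; last 2 first.
- by move=> A mA; rewrite -densityE// setIC.
- exact: measurable_funTS.
rewrite [RHS]ge0_integral_pushforward//; last exact: measurable_funTS.
(* The restriction of [P] to [E] has density [\1_E] with respect to [P]. *)
rewrite [RHS](@ge0_integral_density _ _ _ (mrestr P mE) P \1_E)//=.
- by rewrite setIC integral_mkcondr epatch_indic.
- move=> A mA; by rewrite integral_indic//= /mrestr setIC.
- exact: mpre.
- by apply: measurable_funTS; exact: (measurableT_comp mg mZ).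
Qed.

Lemma integral_transfer (C : set U) (g : U -> R) : measurable C ->
  measurable_fun setT g ->
  (\int[P]_(w in E `&` Z @^-1` C) (g (Z w))%:E =
   \int[rho]_(y in C) (g y * F y)%:E)%E.
Proof.
move=> mC mg; rewrite integralE [RHS]integralE.
have mEg : measurable_fun setT (EFin \o g) by exact/measurable_EFinP.
have -> : (\int[P]_(w in E `&` Z @^-1` C) (fun w => (g (Z w))%:E)^\+ w =
    \int[P]_(w in E `&` Z @^-1` C) (EFin \o g)^\+ (Z w))%E.
  by apply: eq_integral => w _; rewrite !funeposE.
have -> : (\int[P]_(w in E `&` Z @^-1` C) (fun w => (g (Z w))%:E)^\- w =
    \int[P]_(w in E `&` Z @^-1` C) (EFin \o g)^\- (Z w))%E.
  by apply: eq_integral => w _; rewrite !funenegE.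
rewrite !ge0_integral_transfer//; last 2 first.
- exact: measurable_funeneg.
- exact: measurable_funepos.
congr (_ - _)%E; apply: eq_integral => y _.
- by rewrite !funeposE !EFinM maxe_pMl ?lee_fin// mul0e.
- by rewrite !funenegE !EFinM -mulNe maxe_pMl ?lee_fin// mul0e.
Qed.

Lemma integrable_transfer (C : set U) (g : U -> R) : measurable C ->
  measurable_fun setT g ->
  P.-integrable (E `&` Z @^-1` C) (fun w => (g (Z w))%:E) ->
  rho.-integrable C (fun y => (g y * F y)%:E).
Proof.
move=> mC mg /integrableP[_ ig]; apply/integrableP; split.
  by apply/measurable_EFinP/measurable_funTS; exact: measurable_funM.
suff -> : (\int[rho]_(y in C) `|(g y * F y)%:E| =
           \int[P]_(w in E `&` Z @^-1` C) `|(g (Z w))%:E|)%E by [].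
rewrite (@ge0_integral_transfer _ (fun y => `|(g y)%:E|%E))//.
- apply: eq_integral => y _; rewrite EFinM abseM [in RHS]/=.
  by rewrite [`|(F y)%:E|%E]gee0_abs ?lee_fin.
- by apply: measurableT_comp => //; exact/measurable_EFinP.
Qed.

End transfer.

(** * Gaussian moments of real coordinates *)

Section cvec_functional.
Context (R : realType) (M : nat).
Notation V := 'rV[R[i]]_M.
Let lam := cvec_lebesgue R M.

(** Collects what real and imaginary parts of a coordinate have in common, so that each argument is
    made once. Scaling is by real numbers only, since neither part is complex-linear; the quadratic
    bound serves integrability. *)
Record real_coordinate (u : V -> R) : Prop := {
  rc_measurable : measurable_fun setT u;
  rc_add : forall x y, u (x + y) = u x + u y;
  rc_scale : forall (a : R) x, u (a%:C *: x) = a * u x;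
  rc_bound : forall x, `|u x| <= 1 + sqnorm x }.

Lemma real_coordinate_Re j : real_coordinate (fun x : V => complex.Re (x 0 j)).
Proof.
split.
- by have := @measurable_cvec_Re R _ _ M id j (@measurable_id _ _ setT).
- by move=> x y; rewrite mxE raddfD.
- by move=> a x; rewrite mxE; case: (x 0 j) => b c /=; rewrite mul0r subr0.
- move=> x; rewrite /sqnorm (bigD1 j)//=.
  set S := \sum_(_ < _ | _) _.
  have S0 : 0 <= S by apply: sumr_ge0 => k _; rewrite addr_ge0// sqr_ge0.
  case: (x 0 j) => b c /=; have := sqr_ge0 c; have := sqr_ge0 (`|b| - 1).
  have := real_normK (num_real b); nra.
Qed.

Lemma real_coordinate_Im j : real_coordinate (fun x : V => complex.Im (x 0 j)).
Proof.
split.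
- by have := @measurable_cvec_Im R _ _ M id j (@measurable_id _ _ setT).
- by move=> x y; rewrite mxE raddfD.
- by move=> a x; rewrite mxE; case: (x 0 j) => b c /=; rewrite mul0r addr0.
- move=> x; rewrite /sqnorm (bigD1 j)//=.
  set S := \sum_(_ < _ | _) _.
  have S0 : 0 <= S by apply: sumr_ge0 => k _; rewrite addr_ge0// sqr_ge0.
  case: (x 0 j) => c b /=; have := sqr_ge0 c; have := sqr_ge0 (`|b| - 1).
  have := real_normK (num_real b); nra.
Qed.

Variable u : V -> R.
Hypothesis cu : real_coordinate u.

(** Doubling the variance costs [2 ^+ M] in the normalisation and frees a factor [exp (- q)] with
    [q = sqnorm x / (2 * sigma)]. It absorbs the bound on [u], because [1 + 2 * sigma * q <= (1 + 2
    * sigma) * (1 + q)] and [1 + q <= exp q]. *)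
Lemma real_coordinate_cnormal_le sigma x : 0 < sigma ->
  `|u x| * cnormal_pdf sigma x <=
  2 ^+ M * (1 + 2 * sigma) * cnormal_pdf (2 * sigma) x.
Proof.
move=> s0; have q0 := sqnorm_ge0 x; have s20 : 0 < 2 * sigma by rewrite mulr_gt0.
have -> : cnormal_pdf sigma x =
    2 ^+ M * cnormal_pdf (2 * sigma) x * expR (- (sqnorm x / (2 * sigma))).
  rewrite /cnormal_pdf -!mulrA -expRD mulrA.
  congr (_ * expR _).
    rewrite [pi * (2 * sigma)]mulrCA [(2 * _) ^+ M]exprMn invfM mulVKf//.
  by field; rewrite gt_eqF.
have C0 := cnormal_pdf_ge0 x s20.
rewrite mulrCA [leRHS]mulrAC.
rewrite ler_wpM2l//; first by rewrite mulr_ge0// exprn_ge0.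
rewrite expRN ler_pdivrMr ?expR_gt0//.
apply: (le_trans (rc_bound cu x)).
have qs : 0 <= sqnorm x / (2 * sigma) by rewrite divr_ge0// ltW.
have H := expR_ge1Dx (sqnorm x / (2 * sigma)).
have s21 : 0 <= 1 + 2 * sigma by rewrite addr_ge0// ltW.
apply: le_trans (ler_wpM2l s21 H).
have : sqnorm x = 2 * sigma * (sqnorm x / (2 * sigma)).
  by rewrite mulrC divfK// gt_eqF.
by move: (sqnorm x / (2 * sigma)) qs => q q_ge0 ->; nra.
Qed.

Hypothesis mass1 : forall sigma, 0 < sigma ->
  (\int[lam]_x (cnormal_pdf sigma x)%:E = 1)%E.

Let measurable_u_cnormal sigma :
  measurable_fun setT (fun x : V => u x * cnormal_pdf sigma x).
Proof.
by apply: measurable_funM; [exact: rc_measurable cu|exact: measurable_cnormal_pdf].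
Qed.

Lemma integrable_real_coordinate_cnormal sigma : 0 < sigma ->
  lam.-integrable setT (fun x => (u x * cnormal_pdf sigma x)%:E).
Proof.
move=> s0; have s20 : 0 < 2 * sigma by rewrite mulr_gt0.
pose K : R := 2 ^+ M * (1 + 2 * sigma).
have K0 : 0 <= K by rewrite mulr_ge0 ?exprn_ge0// addr_ge0// ltW.
have mf : measurable_fun setT (fun x : V => (cnormal_pdf (2 * sigma) x)%:E).
  by apply/measurable_EFinP; exact: measurable_cnormal_pdf.
apply: (@le_integrable _ _ _ lam setT measurableT _
  (fun x => (K * cnormal_pdf (2 * sigma) x)%:E)) => //.
- exact/measurable_EFinP.
- move=> x _ /=; rewrite lee_fin normrM.
  rewrite (ger0_norm (cnormal_pdf_ge0 x s0)) [`|K * _|]ger0_norm.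
    exact: real_coordinate_cnormal_le.
  by rewrite mulr_ge0// cnormal_pdf_ge0.
apply/integrableP; split.
  by apply/measurable_EFinP/measurable_funM => //; exact/measurable_EFinP.
rewrite (eq_integral (fun x => K%:E * (cnormal_pdf (2 * sigma) x)%:E)%E); last first.
  by move=> x _; rewrite gee0_abs// lee_fin mulr_ge0// cnormal_pdf_ge0.
rewrite ge0_integralZl//; last by move=> x _; rewrite lee_fin cnormal_pdf_ge0.
by rewrite mass1// mule1 ltry.
Qed.

(** The integrand is odd, and [x -> - x] preserves Lebesgue measure and exchanges positive and
    negative parts. Integrability makes their common integral finite, so that the difference is
    0. *)
Lemma integral_real_coordinate_cnormal sigma : 0 < sigma ->
  (\int[lam]_x (u x * cnormal_pdf sigma x)%:E = 0)%E.
Proof.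
move=> s0; pose g x := (u x * cnormal_pdf sigma x)%:E.
have mg : measurable_fun setT g by exact/measurable_EFinP.
have gN (x : V) : g ((- 1 : R)%:C *: x + 0) = (- g x)%E.
  have sN : (- 1 : R) ^+ 2 * sigma = sigma by rewrite sqrrN expr1n mul1r.
  rewrite /g addr0 (rc_scale cu) -{1}sN cnormal_pdfZ ?oppr_eq0 ?oner_eq0//.
  by rewrite sqrrN expr1n invr1 expr1n mul1r mulN1r mulNr EFinN.
have scal := @cvec_lebesgue_scaled_by_affine R M (-1) 0 _ (g^\+)%E
  (measurable_funepos mg) (fun x => funepos_ge0 g x).
rewrite integralE -/g.
have -> : (\int[lam]_x g^\- x = \int[lam]_x g^\+ x)%E.
  rewrite -[RHS]mul1e.
  have -> : 1%:E = ((((-1 : R) ^- 2) ^+ M)%:E) by rewrite sqrrN expr1n invr1 expr1n.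
  rewrite -scal ?oppr_eq0 ?oner_eq0//.
  by apply: eq_integral => x _; rewrite funeposE gN funenegE.
rewrite subee//; apply: integrable_pos_fin_num => //.
exact: integrable_real_coordinate_cnormal.
Qed.

Lemma integrable_real_coordinate_law d (T : measurableType d) (P : probability T R)
    (X : T -> V) sigma :
  0 < sigma -> measurable_fun setT X -> has_cnormal_law P X sigma ->
  P.-integrable setT (fun w => (u (X w))%:E).
Proof.
move=> s0 mX lawX; have mu := rc_measurable cu.
apply/integrableP; split.
  by apply/measurable_EFinP; exact: measurableT_comp.
have /integrableP[_] := integrable_real_coordinate_cnormal s0.
have XE A : measurable A -> P (setT `&` X @^-1` A) =
    (\int[lam]_(x in A) (cnormal_pdf sigma x)%:E)%E.
  by move=> mA; rewrite setTI lawX.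
have := @ge0_integral_transfer _ _ _ _ _ P lam setT X _ measurableT mX
  (@measurable_cnormal_pdf R M sigma) (fun x => cnormal_pdf_ge0 x s0) XE
  setT (fun x => `|(u x)%:E|%E) measurableT.
rewrite preimage_setT setIT => -> //; last first.
  by apply: measurableT_comp => //; exact/measurable_EFinP.
move=> H; apply: le_lt_trans H; rewrite le_eqVlt; apply/orP; left; apply/eqP.
apply: eq_integral => x _; rewrite -EFinM [RHS]/= normrM; congr (_ * _)%:E.
by rewrite ger0_norm// cnormal_pdf_ge0.
Qed.

End cvec_functional.

(** * The observation model *)

(* Frames [t - 1], [t], [t + 1] are [s + k] for [k = 0, 1, 2]; the target frame
   [k = 1] comes first in the tuples of observations. *)
Section model.
Context (R : realType) (d : measure_display) (T : measurableType d).
Context (P : probability T R) (M s : nat).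
Variables (beta p01 p11 pa : R) (e : nat -> R).
Variables (l : nat -> {RV P >-> bool}) (h z : nat -> {RV P >-> 'rV[R[i]]_M}).
Hypotheses (beta_gt0 : 0 < beta) (pa_gt0 : 0 < pa) (pa_lt1 : pa < 1).
Hypothesis e_gt0 : forall k, 0 < e k.
Hypothesis chain_l : activity_chain l p01 p11 pa.
Hypothesis law_h : forall k, (k < 3)%N -> has_cnormal_law P (h (s + k)%N) beta.
Hypothesis law_z : forall k, (k < 3)%N -> has_cnormal_law P (z (s + k)%N) 1.
Hypothesis indep : mutually_independent P (source_sigma s.+1 l h z).
Notation V := 'rV[R[i]]_M.

Let lam := cvec_lebesgue R M.

Let lam2 := sigma_finite_prod lam lam.

Definition scaled_noise k w : V := (Num.sqrt (e k))%:C *: z (s + k)%N w.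

Let sqrt_e_neq0 k : Num.sqrt (e k) != 0.
Proof. by rewrite sqrtr_eq0 -ltNge. Qed.

Let mpre (d' : measure_display) (U : measurableType d') (f : T -> U) (A : set U) :
  measurable_fun setT f -> measurable A -> measurable (f @^-1` A).
Proof. by move=> mf mA; rewrite -[X in measurable X]setTI; exact: mf. Qed.

Lemma measurable_process_sigma E : process_sigma l E -> measurable E.
Proof.
suff : process_sigma l `<=` measurable by exact.
apply: smallest_sub; first exact: sigma_algebra_measurable.
move=> _ [tau _ [B mB <-]]; exact: measurable_funP.
Qed.

Lemma process_sigma_activity tau a : process_sigma l (l tau @^-1` [set a]).
Proof.
apply: sub_sigma_algebra; exists tau => //; exists [set a] => //.
by rewrite setTI.
Qed.

Lemma process_sigmaI A B :
  process_sigma l A -> process_sigma l B -> process_sigma l (A `&` B).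
Proof.
pose G := \bigcup_tau g_sigma_algebra_preimage (l tau).
exact: (@measurableI _ (g_sigma_algebraType G)).
Qed.

Lemma integral_cnormal_pdf1 sigma : 0 < sigma ->
  (\int[lam]_x (cnormal_pdf sigma x)%:E = 1)%E.
Proof.
by move=> s0; exact: integral_cnormal_pdf beta_gt0 s0 (law_h (isT : (0 < 3)%N)).
Qed.

Lemma measurable_scaled_noise k : measurable_fun setT (scaled_noise k).
Proof. exact: (@measurable_cvecZ _ _ _ _ (cst _)). Qed.

Lemma law_scaled_noise k : (k < 3)%N -> has_cnormal_law P (scaled_noise k) (e k).
Proof.
move=> k3; have := has_cnormal_lawZ (sqrt_e_neq0 k) ltr01 (law_z k3).
by rewrite sqr_sqrtr ?mulr1// ltW.
Qed.

Lemma sources_rectangle E (A B : nat -> set V) : process_sigma l E ->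
  (forall k, measurable (A k)) -> (forall k, measurable (B k)) ->
  (P (E `&` \bigcap_(k in `I_3) (h (s + k)%N @^-1` A k `&` scaled_noise k @^-1` B k)) =
   P E * \prod_(k < 3) (\int[lam]_(x in A k) (cnormal_pdf beta x)%:E *
                        \int[lam]_(y in B k) (cnormal_pdf (e k) y)%:E))%E.
Proof.
move=> mE mA mB.
(* One event per source. An event of the scaled noise is an event of [z], through the preimage under
   scaling. *)
pose src (o : option (bool * 'I_3)) : set T := match o with
  | None => E
  | Some (true, k) => h (s + k)%N @^-1` A k
  | Some (false, k) => scaled_noise k @^-1` B k
  end.
have srcP o : source_sigma s.+1 l h z o (src o).
  case: o => [[[] k]|]//=.
  - by exists (A k) => //; rewrite setTI.
  - exists ((fun x => (Num.sqrt (e k))%:C *: x) @^-1` B k); last by rewrite setTI.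
    exact: measurable_cvec_preimageZ.
have := indep (J := finset.setTfor (option (bool * 'I_3))) (fun o _ => srcP o).
have -> : \bigcap_(o in [set` finset.setTfor (option (bool * 'I_3))]) src o =
    E `&` \bigcap_(k in `I_3) (h (s + k)%N @^-1` A k `&` scaled_noise k @^-1` B k).
  apply/seteqP; split => w /=.
    move=> H; split; first by apply: (H None); rewrite /= inE.
    move=> k /= k3; split.
      by apply: (H (Some (true, Ordinal k3))); rewrite /= inE.
    by apply: (H (Some (false, Ordinal k3))); rewrite /= inE.
  move=> [Ew H] [[[] k]|]// _ /=; by have [] := H k (ltn_ord k).
move=> ->; under eq_bigl do rewrite inE.
rewrite (bigD1 None)//=; congr (_ * _)%E.
(* The sources other than the chain are indexed by pairs; summing out the Boolean puts the channel
   and the noise of a frame in one factor. *)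
rewrite (reindex_omap Some id)/=; last by case.
under eq_bigl do rewrite eqxx.
rewrite (eq_bigr (fun p => P (src (Some (p.1, p.2))))); last by case.
rewrite -(pair_bigA _ (fun b k => P (src (Some (b, k)))))/= big_bool/= -big_split/=.
apply: eq_bigr => k _; rewrite (law_h (ltn_ord k))//.
by rewrite (law_scaled_noise (ltn_ord k)).
Qed.

Definition obs (a : bool) (p : V * V) : V := (a%:R : R)%:C *: p.1 + p.2.

Definition obs_var (a : bool) k : R := a%:R * beta + e k.

Lemma obs_var_gt0 a k : 0 < obs_var a k.
Proof. by rewrite ltr_wpDl// mulr_ge0// ltW. Qed.

Lemma measurable_obs a : measurable_fun setT (obs a).
Proof.
apply: measurable_cvecD => //.
exact: (@measurable_cvecZ _ _ _ _ (cst _) fst).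
Qed.

Definition pair_pdf k (p : V * V) := cnormal_pdf beta p.1 * cnormal_pdf (e k) p.2.

(** Inactive: the channel integrates to one. Active: [integral_cnormal_sum] with no constraint on
    the residual. *)
Lemma integral_obs a k B : measurable B ->
  (\int[lam \x lam]_(p in obs a @^-1` B) (pair_pdf k p)%:E =
   \int[lam]_(y in B) (cnormal_pdf (obs_var a k) y)%:E)%E.
Proof.
move=> mB; rewrite /obs_var; case: a => /=; last first.
  have -> : obs false @^-1` B = setT `*` B.
    apply/seteqP; split => p; rewrite /obs/= rmorph0 scale0r add0r//.
    by case.
  rewrite integral_rectangle//; try exact: measurable_cnormal_pdf.
  - by rewrite integral_cnormal_pdf1// mul1e mul0r add0r.
  - by move=> x; exact: cnormal_pdf_ge0.
  - by move=> x; exact: cnormal_pdf_ge0.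
rewrite mul1r; have := integral_cnormal_sum beta_gt0 (e_gt0 k) measurableT mB.
rewrite integral_cnormal_pdf1 ?mul1e; last by rewrite divr_gt0 ?mulr_gt0 ?addr_gt0.
move=> <-; congr integral; rewrite preimage_setT setTI.
by apply/funext => p; rewrite /= /obs rmorph1 scale1r.
Qed.

Definition source_pair k w := (h (s + k)%N w, scaled_noise k w).

Lemma measurable_source_pair k : measurable_fun setT (source_pair k).
Proof. by apply: measurable_fun_pair => //; exact: measurable_scaled_noise. Qed.

(** The density of a neighbouring observation given activity [a] in the target frame, a mixture over
    the activity of the neighbour. By reversibility it serves both neighbours. *)
Definition transition_pdf a k (y : V) : R :=
  transition p01 p11 a true * cnormal_pdf (obs_var true k) y +
  transition p01 p11 a false * cnormal_pdf (obs_var false k) y.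

Let K_ge0 a c : 0 <= transition p01 p11 a c.
Proof. exact: transition_ge0 chain_l pa_gt0 pa_lt1 a c. Qed.

Let obs_pdf_ge0 a k (y : V) : 0 <= cnormal_pdf (obs_var a k) y.
Proof. by apply: cnormal_pdf_ge0; exact: obs_var_gt0. Qed.

Lemma transition_pdf_ge0 a k y : 0 <= transition_pdf a k y.
Proof. by rewrite addr_ge0// mulr_ge0. Qed.

Lemma measurable_transition_pdf a k : measurable_fun setT (transition_pdf a k).
Proof.
by apply: measurable_funD; apply: measurable_funM => //; exact: measurable_cnormal_pdf.
Qed.

(** Real rather than extended values, so that the sums over activities can be settled by [ring]. *)
Let N a k B := fine (\int[lam]_(y in B) (cnormal_pdf (obs_var a k) y)%:E)%E.

Let NE a k B : measurable B ->
  (\int[lam]_(y in B) (cnormal_pdf (obs_var a k) y)%:E = (N a k B)%:E)%E.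
Proof.
move=> mB; rewrite fineK// ge0_fin_numE; last first.
  by apply: integral_ge0 => y _; rewrite lee_fin.
apply: (@le_lt_trans _ _ 1%E); last by rewrite ltry.
rewrite -(integral_cnormal_pdf1 (obs_var_gt0 a k)); apply: ge0_subset_integral => //.
  by apply/measurable_EFinP; exact: measurable_cnormal_pdf.
by move=> y _; rewrite lee_fin.
Qed.

Lemma integral_transition_pdf a k B : measurable B ->
  (\int[lam]_(y in B) (transition_pdf a k y)%:E =
   (transition p01 p11 a true * N true k B +
    transition p01 p11 a false * N false k B)%:E)%E.
Proof.
move=> mB; rewrite EFinD !EFinM -!NE//.
have mE c : measurable_fun B (fun y : V => (cnormal_pdf (obs_var c k) y)%:E).
  by apply/measurable_EFinP/measurable_funTS; exact: measurable_cnormal_pdf.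
have pE0 c (y : V) : B y -> (0 <= (cnormal_pdf (obs_var c k) y)%:E)%E.
  by rewrite lee_fin.
rewrite -(ge0_integralZl _ mB (mE _) (pE0 _)) ?lee_fin//.
rewrite -(ge0_integralZl _ mB (mE _) (pE0 _)) ?lee_fin//.
rewrite -ge0_integralD//.
- by move=> y By; rewrite mule_ge0 ?pE0// lee_fin.
- exact: emeasurable_funM.
- by move=> y By; rewrite mule_ge0 ?pE0// lee_fin.
- exact: emeasurable_funM.
Qed.

Let r k w := observation l h z (e k) (s + k)%N w.

Lemma observationE k w : r k w = obs (l (s + k)%N w) (source_pair k w).
Proof.
rewrite /r /observation /signal /obs /source_pair /scaled_noise/=.
by rewrite rmorph_nat.
Qed.

Lemma measurable_observation k : measurable_fun setT (r k).
Proof.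
apply: measurable_cvecD; last exact: measurable_scaled_noise.
rewrite (_ : signal _ _ _ = fun w => ((l (s + k)%N w)%:R : R)%:C *: h (s + k)%N w).
  apply: measurable_cvecZ => //.
  exact: (measurableT_comp (f := fun a : bool => a%:R : R)).
by apply/funext => w; rewrite /signal rmorph_nat.
Qed.

Lemma sources_pairs E (C : nat -> set (V * V)) : process_sigma l E ->
  (forall k, measurable (C k)) ->
  (P (E `&` \bigcap_(k in `I_3) (source_pair k @^-1` C k)) =
   P E * \prod_(k < 3) \int[lam \x lam]_(p in C k) (pair_pdf k p)%:E)%E.
Proof.
move=> pE mC.
apply: (independent_pairs (X := fun k => h (s + k)%N) integral_cnormal_pdf1) => //.
- by move=> k _; exact: measurable_scaled_noise.
- exact: measurable_process_sigma.
- by move=> A B mA mB; exact: sources_rectangle.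
Qed.

(** [D1] is an additional event on channel and noise of the target frame, and [kD] the factor it
    contributes. Later uses take [setT] with factor 1 for the law of the observations, and an event
    of the residual for its independence. *)
Lemma joint_chain_obs b D1 kD B0 B1 B2 : measurable D1 ->
  measurable B0 -> measurable B1 -> measurable B2 ->
  (\int[lam \x lam]_(p in D1 `&` obs b @^-1` B1) (pair_pdf 1 p)%:E =
   (kD * N b 1 B1)%:E)%E ->
  P (l s.+1 @^-1` [set b] `&` source_pair 1 @^-1` D1 `&`
    (r 1 @^-1` B1 `&` (r 0 @^-1` B0 `&` r 2 @^-1` B2))) =
  (kD%:E * (\int[lam]_(y in B1)
              (activity_prob pa b * cnormal_pdf (obs_var b 1) y)%:E *
     (\int[lam]_(y in B0) (transition_pdf b 0 y)%:E *
      \int[lam]_(y in B2) (transition_pdf b 2 y)%:E)))%E.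
Proof.
move=> mD1 mB0 mB1 mB2 HD1.
set S := (X in P X).
have mobs a (B : set V) : measurable B -> measurable (obs a @^-1` B).
  by move=> mB; rewrite -[X in measurable X]setTI; exact: measurable_obs.
have mS : measurable S.
  apply: measurableI; first apply: measurableI.
  - exact: measurable_activity.
  - by apply: mpre => //; exact: measurable_source_pair.
  - by do ![apply: measurableI]; apply: mpre => //; exact: measurable_observation.
(* Once all three activities are fixed, each observation is a function of its own source pair, and
   the probability factorises. The claim is the sum of these four terms. *)
have term a0 a2 : P (S `&` l s @^-1` [set a0] `&` l s.+2 @^-1` [set a2]) =
    (activity_prob pa b * transition p01 p11 b a0 * transition p01 p11 b a2 *
     (N a0 0 B0 * (kD * N b 1 B1) * N a2 2 B2))%:E.
  pose C k := match k with
    | 0 => obs a0 @^-1` B0 | 1 => D1 `&` obs b @^-1` B1 | _ => obs a2 @^-1` B2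
    end.
  pose E := l s @^-1` [set a0] `&` l s.+1 @^-1` [set b] `&` l s.+2 @^-1` [set a2].
  have pE : process_sigma l E.
    by apply: process_sigmaI; [apply: process_sigmaI|];
      exact: process_sigma_activity.
  rewrite (_ : _ `&` _ = E `&` \bigcap_(k in `I_3) (source_pair k @^-1` C k)).
    rewrite sources_pairs//; last first.
      move=> [|[|k]]; rewrite /C//; try exact: mobs.
      by apply: measurableI => //; exact: mobs.
    rewrite /E (measure_activity3 chain_l pa_gt0 pa_lt1).
    rewrite !big_ord_recl big_ord0 /C/= HD1 !integral_obs// !NE// -!EFinM.
    by congr EFin; rewrite mulr1 -!mulrA.
  rewrite !IIS !bigcap_setU !bigcap_set1 II0 bigcap_set0 setTI.
  have r0E w : l s w = a0 -> r 0 w = obs a0 (source_pair 0 w).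
    by rewrite observationE addn0 => ->.
  have r1E w : l s.+1 w = b -> r 1 w = obs b (source_pair 1 w).
    by rewrite observationE addn1 => ->.
  have r2E w : l s.+2 w = a2 -> r 2 w = obs a2 (source_pair 2 w).
    by rewrite observationE addn2 => ->.
  apply/seteqP; split => w /=.
    move=> [[[[l1 Dw] [rB1 [rB0 rB2]]] l0] l2].
    by rewrite -r0E// -r1E// -r2E.
  move=> [[[l0 l1] l2] [[oB0 [Dw oB1]] oB2]].
  by rewrite /S/= r0E// r1E// r2E.
have Zf : (\int[lam]_(y in B1)
    (activity_prob pa b * cnormal_pdf (obs_var b 1) y)%:E =
    (activity_prob pa b * N b 1 B1)%:E)%E.
  rewrite EFinM -NE// -ge0_integralZl//.
  - by apply/measurable_EFinP/measurable_funTS; exact: measurable_cnormal_pdf.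
  - by move=> y _; rewrite lee_fin.
  - by rewrite lee_fin ltW// activity_prob_gt0.
have mSs a : measurable (S `&` l s @^-1` [set a]).
  by apply: measurableI => //; exact: measurable_activity.
rewrite (measure_activity_split l s)//.
rewrite (measure_activity_split l s.+2 (mSs true)).
rewrite (measure_activity_split l s.+2 (mSs false)).
rewrite !term Zf !integral_transition_pdf// -!EFinM -!EFinD; congr EFin.
move: (N true 0%N B0) (N false 0%N B0) (N b 1%N B1) (N true 2%N B2) (N false 2%N B2).
by move=> x0 y0 x1 x2 y2; ring.
Qed.

(** The prior weight is included: this is the density of the observations on the event that the
    target activity is [b], not conditionally on it. *)
Definition frames_pdf b (y : V * (V * V)) : R :=
  activity_prob pa b * cnormal_pdf (obs_var b 1) y.1 *
  (transition_pdf b 0 y.2.1 * transition_pdf b 2 y.2.2).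

Lemma joint_obs b D1 kD C : measurable D1 -> measurable C -> 0 <= kD ->
  (forall B, measurable B ->
    \int[lam \x lam]_(p in D1 `&` obs b @^-1` B) (pair_pdf 1 p)%:E =
    kD%:E * \int[lam]_(y in B) (cnormal_pdf (obs_var b 1) y)%:E)%E ->
  P (l s.+1 @^-1` [set b] `&` source_pair 1 @^-1` D1 `&`
    (fun w => (r 1 w, (r 0 w, r 2 w))) @^-1` C) =
  (kD%:E * \int[lam \x lam2]_(y in C) (frames_pdf b y)%:E)%E.
Proof.
move=> mD1 mC kD0 HD1.
set S := _ `&` source_pair 1 @^-1` D1.
have mS : measurable S.
  apply: measurableI; first exact: measurable_activity.
  by apply: mpre => //; exact: measurable_source_pair.
have mtr k := measurable_transition_pdf b k.
have mr := measurable_observation.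
have tr0 := transition_pdf_ge0 b.
have pb0 : 0 <= activity_prob pa b by rewrite ltW// activity_prob_gt0.
pose f (y : V) := activity_prob pa b * cnormal_pdf (obs_var b 1) y.
have mf : measurable_fun setT f.
  by apply: measurable_funM => //; exact: measurable_cnormal_pdf.
have f0 y : 0 <= f y by rewrite mulr_ge0.
pose g (y : V * V) := transition_pdf b 0 y.1 * transition_pdf b 2 y.2.
have mg : measurable_fun setT g.
  apply: measurable_funM.
    exact: (measurableT_comp (mtr 0%N) measurable_fst).
  exact: (measurableT_comp (mtr 2%N) measurable_snd).
have g0 y : 0 <= g y by rewrite mulr_ge0.
have := (@joint_density_event _ _ _ _ _ lam lam2 _ _ P S (r 1) (fun w => (r 0 w, r 2 w))
  f g kD mS (mr 1%N) (measurable_fun_pair (mr 0%N) (mr 2%N)) mf f0 mg g0 kD0 _ C mC).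
move=> H; rewrite H; [by []|]; clear H.
move=> B1 C' mB1 mC'.
(* The extension from rectangles is done twice: the target against the two neighbours, then the
   neighbours against each other. In the second pass the finite mass [n] of the target joins the
   constant. *)
have [n [n0 fn]] : exists n, 0 <= n /\ (\int[lam]_(y in B1) (f y)%:E = n%:E)%E.
  exists (activity_prob pa b * N b 1 B1); split.
    by rewrite mulr_ge0// fine_ge0// integral_ge0// => y _; rewrite lee_fin.
  rewrite EFinM -NE// -ge0_integralZl//.
  - by apply/measurable_EFinP/measurable_funTS; exact: measurable_cnormal_pdf.
  - by move=> y _; rewrite lee_fin.
have mSB1 : measurable (S `&` r 1 @^-1` B1) by apply: measurableI => //; exact: mpre.
have kn0 : 0 <= kD * n by exact: mulr_ge0.
rewrite fn muleA -EFinM setIA.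
apply: (@joint_density_event _ _ _ _ _ lam lam _ _ P _ (r 0) (r 2)
  _ _ _ mSB1 (mr 0%N) (mr 2%N) (mtr 0%N) (tr0 0%N) (mtr 2%N) (tr0 2%N) kn0 _ C' mC').
move=> B0 B2 mB0 mB2; rewrite EFinM -fn -muleA -setIA.
by apply: joint_chain_obs => //; rewrite HD1// NE.
Qed.

Lemma measure_activity_obs k b A : (k < 3)%N -> measurable A ->
  P (l (s + k)%N @^-1` [set b] `&` r k @^-1` A) =
  ((activity_prob pa b)%:E *
   \int[lam]_(y in A) (cnormal_pdf (obs_var b k) y)%:E)%E.
Proof.
move=> k3 mA; set E := l (s + k)%N @^-1` [set b].
pose C j := if j == k then obs b @^-1` A else setT.
have mC j : measurable (C j).
  rewrite /C; case: ifP => // _.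
  by rewrite -[X in measurable X]setTI; exact: measurable_obs.
have := sources_pairs (process_sigma_activity (s + k) b) mC.
rewrite -/E (measure_activity chain_l) (bigD1 (Ordinal k3))//=.
rewrite {2}/C eqxx integral_obs// big1 => [|j jk]; last first.
  rewrite /C ifF; last first.
    by apply/negbTE; move: jk; apply: contra_neq => ?; exact: val_inj.
  have := integral_obs false j measurableT.
  by rewrite preimage_setT integral_cnormal_pdf1// obs_var_gt0.
rewrite mule1 => <-; congr (P _); apply/seteqP; split => w /= [Ew].
  move=> rA; split => // j /= j3; rewrite /C; case: eqP => [->|//] /=.
  by move: rA; rewrite /= observationE Ew.
by move=> /(_ k k3); rewrite /C eqxx /= observationE Ew.
Qed.

Lemma cond_density_obs k b : (k < 3)%N ->
  is_cond_density P (r k) (l (s + k)%N @^-1` [set b]) (cnormal_pdf (obs_var b k)).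
Proof.
move=> k3; split; [exact: measurable_cnormal_pdf|by []|move=> A mA].
rewrite /cond_prob setIC measure_activity_obs// (measure_activity chain_l) NE//=.
by rewrite mulrAC divff ?mul1r// gt_eqF// activity_prob_gt0.
Qed.

(** Conditional densities are almost everywhere unique, so any two versions may be replaced by the
    Gaussian densities, whose quotient is [upsilon]. *)
Lemma inverse_likelihood_ratio_obs k : (k < 3)%N ->
  is_inverse_likelihood_ratio P (r k) (l (s + k)%N) (upsilon beta (e k)).
Proof.
move=> k3; split; try by eexists; exact: cond_density_obs.
move=> q0 q1 [mq0 q0_ge0 Hq0] [mq1 q1_ge0 Hq1].
have uniq b q : measurable_fun setT q ->
    (forall A, measurable A ->
      (cond_prob P (r k @^-1` A) (l (s + k)%N @^-1` [set b]))%:E =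
      (\int[lam]_(y in A) (q y)%:E)%E) ->
    ae_eq lam setT (EFin \o (cnormal_pdf (obs_var b k) : V -> R)) (EFin \o q).
  move=> mq Hq; have [mf f0 Hf] := cond_density_obs b k3.
  apply: integral_ae_eq => //.
  - apply/integrableP; split; first exact/measurable_EFinP.
    rewrite (eq_integral (fun x => (cnormal_pdf (obs_var b k) x)%:E)).
      by rewrite integral_cnormal_pdf1 ?ltry// obs_var_gt0.
    by move=> x _; rewrite /= ger0_norm.
  - exact/measurable_EFinP.
  - by move=> A _ mA; rewrite -Hq// Hf.
have H0 := uniq false _ mq0 Hq0; have H1 := uniq true _ mq1 Hq1.
apply: filterS2 H0 H1 => y /(_ I)/= [<-] /(_ I)/= [<-].
rewrite /obs_var mul0r add0r mul1r (cnormal_pdf_upsilon _ beta_gt0 (e_gt0 k)).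
by rewrite mulfK// gt_eqF// cnormal_pdf_gt0// addr_gt0.
Qed.

(** The odds of inactivity against activity given the three observations. *)
Definition posterior_odds (y : V * (V * V)) : R :=
  phi p01 p11 pa (upsilon beta (e 1) y.1)
    (upsilon beta (e 0) y.2.1) (upsilon beta (e 2) y.2.2).

Let ups_gt0 k (y : V) : 0 < upsilon beta (e k) y.
Proof. exact: upsilon_gt0. Qed.

(** The two transition probabilities are nonnegative with sum 1, so one of them is positive. This
    keeps the denominators of [phi] away from 0 even when [p11] is 0 or 1. *)
Let mixture_gt0 b v : 0 < v ->
  0 < transition p01 p11 b true + transition p01 p11 b false * v.
Proof.
move=> v0.
have Kf : transition p01 p11 b false = 1 - transition p01 p11 b true by case: (b).
have := K_ge0 b false; rewrite Kf; have := K_ge0 b true.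
move: (transition _ _ _ _) => p; rewrite le_eqVlt => /predU1P[<- _|p0 Hp].
  by rewrite add0r subr0 mul1r.
by rewrite ltr_pwDl// mulr_ge0// ltW.
Qed.

Lemma transition_pdfE b k y : transition_pdf b k y =
  (transition p01 p11 b true + transition p01 p11 b false * upsilon beta (e k) y) *
  cnormal_pdf (beta + e k) y.
Proof.
rewrite /transition_pdf /obs_var mul1r mul0r add0r.
rewrite (cnormal_pdf_upsilon _ beta_gt0 (e_gt0 k)) [RHS]mulrDl.
by congr (_ + _); rewrite mulrA.
Qed.

(** By [transition_pdfE] both sides contain the active density of every frame as a factor; what
    remains is the prior ratio, [upsilon] of the target and a quotient of mixtures per neighbour. *)
Lemma frames_pdf_odds y : frames_pdf false y = posterior_odds y * frames_pdf true y.
Proof.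
rewrite /frames_pdf /posterior_odds /phi !transition_pdfE /obs_var.
rewrite mul1r mul0r add0r (cnormal_pdf_upsilon _ beta_gt0 (e_gt0 1)).
have := mixture_gt0 true (ups_gt0 0 y.2.1); have := mixture_gt0 true (ups_gt0 2 y.2.2).
rewrite /transition /activity_prob.
move: (upsilon _ _ _) (upsilon _ _ _) (upsilon _ _ _) => v1 v0 v2.
move: (cnormal_pdf _ _) (cnormal_pdf _ _) (cnormal_pdf _ _) => x1 x0 x2 H2 H0.
by field; rewrite !gt_eqF.
Qed.

Lemma posterior_odds_ge0 y : 0 <= posterior_odds y.
Proof.
have H0 b := mixture_gt0 b (ups_gt0 0 y.2.1).
have H2 b := mixture_gt0 b (ups_gt0 2 y.2.2).
have v1 := ltW (ups_gt0 1 y.1); rewrite /posterior_odds /phi.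
apply: mulr_ge0; [apply: mulr_ge0; [apply: mulr_ge0 => //|]|].
- by apply: divr_ge0; rewrite ?subr_ge0; exact: ltW.
- exact: divr_ge0 (ltW (H0 false)) (ltW (H0 true)).
- exact: divr_ge0 (ltW (H2 false)) (ltW (H2 true)).
Qed.

Lemma measurable_posterior_odds : measurable_fun setT posterior_odds.
Proof.
have mu1 : measurable_fun setT (fun y : V * (V * V) => upsilon beta (e 1) y.1).
  exact: (measurableT_comp (measurable_upsilon beta (e 1)) measurable_fst).
have mu0 : measurable_fun setT (fun y : V * (V * V) => upsilon beta (e 0) y.2.1).
  exact: (measurableT_comp (measurable_upsilon beta (e 0))
    (measurableT_comp measurable_fst measurable_snd)).
have mu2 : measurable_fun setT (fun y : V * (V * V) => upsilon beta (e 2) y.2.2).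
  exact: (measurableT_comp (measurable_upsilon beta (e 2))
    (measurableT_comp measurable_snd measurable_snd)).
have maff (a b : R) (f : V * (V * V) -> R) : measurable_fun setT f ->
    measurable_fun setT (fun y => a + b * f y).
  by move=> mf; apply: measurable_funD => //; exact: measurable_funM.
have minv (f : V * (V * V) -> V) k :
    measurable_fun setT (fun y => upsilon beta (e k) (f y)) ->
    measurable_fun setT (fun y => (p11 + (1 - p11) * upsilon beta (e k) (f y))^-1).
  move=> mf; apply: measurable_fun_inv_pos; first exact: maff.
  by move=> y; exact: (mixture_gt0 true (ups_gt0 k (f y))).
rewrite /posterior_odds /phi.
by do ![apply: measurable_funM => //]; first [exact: maff|exact: minv].
Qed.

Definition denoiser (y : V * (V * V)) : V :=
  mmse_denoiser beta p01 p11 pa (e 1) (e 0) (e 2) y.1 y.2.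

Lemma measurable_denoiser : measurable_fun setT denoiser.
Proof.
apply: measurable_cvecZ; last exact: measurable_fst.
apply: measurable_funM => //; apply: measurable_fun_inv_pos.
  by apply: measurable_funD => //; exact: measurable_posterior_odds.
by move=> y; rewrite ltr_pwDl// posterior_odds_ge0.
Qed.

(** * The conditional expectation, one real coordinate at a time *)

Section coordinate.
Variable u : V -> R.
Hypothesis cu : real_coordinate u.

Let x w := signal l h s.+1 w.
Let Z w := (r 1 w, (r 0 w, r 2 w)).

Let c := beta / (beta + e 1).
Let sig := beta * e 1 / (beta + e 1).
Let mu := rc_measurable cu.

Lemma integrable_channel : P.-integrable setT (fun w => (u (h (s + 1)%N w))%:E).
Proof.
have mh : measurable_fun setT (h (s + 1)%N) by [].
exact: (integrable_real_coordinate_law cu integral_cnormal_pdf1 beta_gt0 mh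
  (law_h (isT : (1 < 3)%N))).
Qed.

Lemma integrable_scaled_noise : P.-integrable setT (fun w => (u (scaled_noise 1 w))%:E).
Proof.
exact: (integrable_real_coordinate_law cu integral_cnormal_pdf1 (e_gt0 1)
  (measurable_scaled_noise 1)
  (law_scaled_noise (isT : (1 < 3)%N))).
Qed.

Lemma signalE w : u (x w) = (l s.+1 w)%:R * u (h (s + 1)%N w).
Proof. by rewrite /x /signal addn1 -(rc_scale cu) rmorph_nat. Qed.

Lemma integrable_signal : P.-integrable setT (fun w => (u (x w))%:E).
Proof.
have ih := integrable_channel.
apply: (le_integrable _ _ _ ih) => //.
  apply/measurable_EFinP; under eq_fun do rewrite signalE.
  have mh : measurable_fun setT (h (s + 1)%N) by [].
  apply: measurable_funM; last exact: (measurableT_comp mu mh).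
  exact: (measurableT_comp (f := fun a : bool => a%:R : R)).
move=> w _ /=; rewrite lee_fin signalE normrM.
by case: (l s.+1 w); rewrite ?normr1 ?mul1r// normr0 mul0r.
Qed.

Lemma observation_targetE w : u (r 1 w) = u (x w) + u (scaled_noise 1 w).
Proof. by rewrite -(rc_add cu) /r /observation /x /scaled_noise addn1. Qed.

Lemma integrable_observation : P.-integrable setT (fun w => (u (r 1 w))%:E).
Proof.
under eq_fun do rewrite observation_targetE EFinD.
by apply: integrableD => //; [exact: integrable_signal|exact: integrable_scaled_noise].
Qed.

Let gain y := (1 + e 1 / beta)^-1 / (1 + posterior_odds y).

Lemma denoiserE y : u (denoiser y) = gain y * u y.1.
Proof. by rewrite /denoiser /mmse_denoiser (rc_scale cu). Qed.

(** Dominates the denoiser by the target observation, which is how its integrability is obtained. *)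
Lemma gain_bound y : `|gain y| <= 1.
Proof.
have q0 := posterior_odds_ge0 y.
have g1 : 1 <= 1 + e 1 / beta by rewrite lerDl; apply: divr_ge0; exact: ltW.
have g2 : 1 <= 1 + posterior_odds y by rewrite lerDl.
have g0 : 0 < 1 + e 1 / beta by exact: lt_le_trans g1.
have g3 : 0 < 1 + posterior_odds y by exact: lt_le_trans g2.
rewrite ger0_norm; last by apply: divr_ge0; rewrite ?invr_ge0; exact: ltW.
by rewrite ler_pdivrMr// mul1r (le_trans _ g2)// invf_le1.
Qed.

Let mZ : measurable_fun setT Z.
Proof. by do ![apply: measurable_fun_pair]; exact: measurable_observation. Qed.

Lemma integrable_denoiser : P.-integrable setT (fun w => (u (denoiser (Z w)))%:E).
Proof.
have ir := integrable_observation.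
apply: (le_integrable _ _ _ ir) => //.
  apply/measurable_EFinP; apply: (measurableT_comp mu).
  exact: (measurableT_comp measurable_denoiser mZ).
move=> w _ /=; rewrite lee_fin denoiserE normrM.
by rewrite ler_piMl// gain_bound.
Qed.

Let target b := l s.+1 @^-1` [set b].

Lemma Rintegral_target_split f C : measurable C ->
  P.-integrable setT (fun w => (f w)%:E) ->
  \int[P]_(w in Z @^-1` C) f w =
  \int[P]_(w in target true `&` Z @^-1` C) f w +
  \int[P]_(w in target false `&` Z @^-1` C) f w.
Proof.
move=> mC iF; rewrite -Rintegral_setU.
- congr Rintegral; rewrite -setIUl.
  apply/seteqP; split => [w Zw|w []//]; split => //.
  by rewrite /target/=; case: (l s.+1 w); [left|right].
- by apply: measurableI; [exact: measurable_activity|exact: mpre].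
- by apply: measurableI; [exact: measurable_activity|exact: mpre].
- apply: integrableS iF => //; apply: measurableU; apply: measurableI;
  by [exact: measurable_activity|exact: mpre].
- by apply/disj_setPS => w [[lt _] [lf _]]; move: lt lf; rewrite /target/= => ->.
Qed.

Lemma target_density b C : measurable C ->
  P (target b `&` Z @^-1` C) = (\int[lam \x lam2]_(y in C) (frames_pdf b y)%:E)%E.
Proof.
move=> mC; have := @joint_obs b setT 1 C measurableT mC ler01.
rewrite mul1e preimage_setT setIT => -> // B mB.
by rewrite setTI mul1e integral_obs.
Qed.

Let residual (p : V * V) : V := p.1 - c%:C *: (p.1 + p.2).

Let measurable_residual : measurable_fun setT residual.
Proof.
rewrite (_ : residual = fun p => p.1 + (- c)%:C *: (p.1 + p.2)); last first.
  by apply/funext => p; rewrite /residual rmorphN scaleNr.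
apply: measurable_cvecD => //.
by apply: (@measurable_cvecZ _ _ _ _ (cst _)) => //; exact: measurable_cvecD.
Qed.

Let be0 : 0 < beta + e 1. Proof. exact: addr_gt0. Qed.

Let sig0 : 0 < sig. Proof. by rewrite divr_gt0// mulr_gt0. Qed.

(* Given activity, the residual [h - c r] is independent of all the observations. *)
Lemma residual_density C A : measurable C -> measurable A ->
  P (target true `&` Z @^-1` C `&` (residual \o source_pair 1) @^-1` A) =
  (\int[lam]_(y in A) (fine (P (target true `&` Z @^-1` C)) *
                       cnormal_pdf sig y)%:E)%E.
Proof.
move=> mC mA; have s0 (y : V) : 0 <= cnormal_pdf sig y by exact: cnormal_pdf_ge0.
have ms := @measurable_cnormal_pdf R M sig.
set N1 := (\int[lam]_(y in A) (cnormal_pdf sig y)%:E)%E.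
have N10 : (0 <= N1)%E by apply: integral_ge0 => y _; rewrite lee_fin.
have N1fin : N1 \is a fin_num.
  rewrite ge0_fin_numE//; apply: (@le_lt_trans _ _ 1%E); last by rewrite ltry.
  rewrite -(integral_cnormal_pdf1 sig0); apply: ge0_subset_integral => //.
    exact/measurable_EFinP.
  by move=> y _; rewrite lee_fin.
have mtC : measurable (target true `&` Z @^-1` C).
  by apply: measurableI; [exact: measurable_activity|exact: mpre].
under eq_integral do rewrite EFinM.
rewrite ge0_integralZl//; last 3 first.
- by apply/measurable_EFinP/measurable_funTS.
- by move=> y _; rewrite lee_fin.
- by rewrite lee_fin fine_ge0.
rewrite -/N1 fineK ?fin_num_measure// target_density//.
have mrA : measurable (residual @^-1` A).
  by rewrite -[X in measurable X]setTI; exact: measurable_residual.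
(* The additional event is now one of the residual, and its factor is the Gaussian mass of [A]. *)
have := @joint_obs true (residual @^-1` A) (fine N1) C mrA mC.
rewrite fine_ge0// fineK// => /(_ erefl).
rewrite muleC => <- //.
  by rewrite setIAC comp_preimage.
move=> B mB; have := integral_cnormal_sum beta_gt0 (e_gt0 1) mA mB.
rewrite /obs_var mul1r -/sig -/N1 => <-; congr integral.
by congr (_ `&` _); apply/funext => p; rewrite /= /obs rmorph1 scale1r.
Qed.

(** On the active event, also restricted by the observations, the residual has a multiple of a
    centred Gaussian density, so its mean vanishes. *)
Lemma Rintegral_residual C : measurable C ->
  \int[P]_(w in target true `&` Z @^-1` C) u (residual (source_pair 1 w)) = 0.
Proof.
move=> mC; have mtC : measurable (target true `&` Z @^-1` C).
  by apply: measurableI; [exact: measurable_activity|exact: mpre].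
pose k := fine (P (target true `&` Z @^-1` C)).
have k0 : 0 <= k by rewrite fine_ge0.
have := @integral_transfer _ _ _ _ _ P lam (target true `&` Z @^-1` C)
  (residual \o source_pair 1) (fun y => k * cnormal_pdf sig y) mtC.
move=> /(_ (measurableT_comp measurable_residual (measurable_source_pair 1))).
move=> /(_ (measurable_funM _ (@measurable_cnormal_pdf R M sig))).
move=> /(_ (measurable_cst _)).
move=> /(_ (fun y => mulr_ge0 k0 (cnormal_pdf_ge0 y sig0))).
move=> /(_ (fun A mA => residual_density mC mA) setT u measurableT mu).
rewrite preimage_setT setIT /Rintegral => ->.
rewrite (eq_integral (fun y => k%:E * (u y * cnormal_pdf sig y)%:E)%E); last first.
  by move=> y _; rewrite -EFinM mulrCA.
rewrite integralZl//; last first.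
  exact: (integrable_real_coordinate_cnormal cu integral_cnormal_pdf1 sig0).
by rewrite (integral_real_coordinate_cnormal cu integral_cnormal_pdf1 sig0) mule0.
Qed.

Let integrable_residual :
  P.-integrable setT (fun w => (u (residual (source_pair 1 w)))%:E).
Proof.
rewrite (_ : (fun _ => _) = fun w => ((1 - c)%:E * (u (h (s + 1)%N w))%:E +
    (- c)%:E * (u (scaled_noise 1 w))%:E)%E); last first.
  apply/funext => w; rewrite -!EFinM -EFinD; congr EFin.
  rewrite /residual/= -scaleNr -rmorphN (rc_add cu) (rc_scale cu) (rc_add cu).
  by ring.
apply: integrableD => //; apply: integrableZl => //.
- exact: integrable_channel.
- exact: integrable_scaled_noise.
Qed.

Let signal_active w : target true w ->
  u (x w) = u (residual (source_pair 1 w)) + c * u (r 1 w).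
Proof.
rewrite /target/= => lw; rewrite observation_targetE !signalE lw mul1r.
rewrite /residual/= -scaleNr -rmorphN (rc_add cu) (rc_scale cu) (rc_add cu).
by ring.
Qed.

Let signal_inactive w : target false w -> u (x w) = 0.
Proof. by rewrite /target/= => lw; rewrite signalE lw mul0r. Qed.

Lemma frames_pdf_ge0 b y : 0 <= frames_pdf b y.
Proof.
apply: mulr_ge0; last by apply: mulr_ge0; exact: transition_pdf_ge0.
by apply: mulr_ge0 => //; rewrite ltW// activity_prob_gt0.
Qed.

Lemma measurable_frames_pdf b : measurable_fun setT (frames_pdf b).
Proof.
apply: measurable_funM; apply: measurable_funM => //.
- exact: (measurableT_comp (@measurable_cnormal_pdf R M (obs_var b 1)) measurable_fst).
- exact: (measurableT_comp (measurable_transition_pdf b 0)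
    (measurableT_comp measurable_fst measurable_snd)).
- exact: (measurableT_comp (measurable_transition_pdf b 2)
    (measurableT_comp measurable_snd measurable_snd)).
Qed.

Lemma Rintegral_target (g : V * (V * V) -> R) b C : measurable C ->
  measurable_fun setT g ->
  \int[P]_(w in target b `&` Z @^-1` C) g (Z w) =
  \int[(lam \x lam2)%E]_(y in C) (g y * frames_pdf b y).
Proof.
move=> mC mg; rewrite /Rintegral.
have := @integral_transfer _ _ _ _ _ P (sigma_finite_prod lam lam2) (target b) Z
  (frames_pdf b) (measurable_activity l s.+1 b) mZ (measurable_frames_pdf b)
  (frames_pdf_ge0 b) (target_density b) C g mC mg.
by move=> ->.
Qed.

Lemma integrable_target (g : V * (V * V) -> R) b C : measurable C ->
  measurable_fun setT g -> P.-integrable setT (fun w => (g (Z w))%:E) ->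
  (sigma_finite_prod lam lam2).-integrable C (fun y => (g y * frames_pdf b y)%:E).
Proof.
move=> mC mg ig.
apply: (@integrable_transfer _ _ _ _ _ P (sigma_finite_prod lam lam2) (target b) Z
  (frames_pdf b) (measurable_activity l s.+1 b) mZ (measurable_frames_pdf b)
  (frames_pdf_ge0 b) (target_density b) C g mC mg).
apply: integrableS ig => //.
by apply: measurableI; [exact: measurable_activity|exact: mpre].
Qed.

Lemma Rintegral_denoiser C : measurable C ->
  \int[P]_(w in Z @^-1` C) u (denoiser (Z w)) = \int[P]_(w in Z @^-1` C) u (x w).
Proof.
move=> mC.
have mtC b : measurable (target b `&` Z @^-1` C).
  by apply: measurableI; [exact: measurable_activity|exact: mpre].
have iS f b : P.-integrable setT (fun w => (f w)%:E) ->
    P.-integrable (target b `&` Z @^-1` C) (fun w => (f w)%:E).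
  by apply: integrableS.
rewrite (Rintegral_target_split mC integrable_signal).
rewrite (Rintegral_target_split mC integrable_denoiser).
have -> : \int[P]_(w in target false `&` Z @^-1` C) u (x w) = 0.
  under eq_Rintegral => w /set_mem[lw _] do rewrite signal_inactive//.
  by rewrite /Rintegral integral0.
have -> : \int[P]_(w in target true `&` Z @^-1` C) u (x w) =
    \int[P]_(w in target true `&` Z @^-1` C) (c * u (Z w).1).
  rewrite -[RHS]add0r -(Rintegral_residual mC) -RintegralD//.
  - by apply: eq_Rintegral => w /set_mem[lw _]; rewrite signal_active.
  - exact: (iS (fun w => u (residual (source_pair 1 w)))).
  - apply: (iS (fun w => c * u (r 1 w))).
    under eq_fun do rewrite EFinM.
    by apply: integrableZl => //; exact: integrable_observation.
have mden : measurable_fun setT (fun y => u (denoiser y)).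
  exact: (measurableT_comp mu measurable_denoiser).
have mlin : measurable_fun setT (fun y : V * (V * V) => c * u y.1).
  by apply: measurable_funM => //; exact: (measurableT_comp mu measurable_fst).
(* From here all integrals are over observations: the denoiser against the sum of both densities,
   [c * u] against the active one. *)
rewrite addr0 (Rintegral_target (g := fun y => u (denoiser y)) true mC mden).
rewrite (Rintegral_target (g := fun y => u (denoiser y)) false mC mden).
rewrite (Rintegral_target (g := fun y => c * u y.1) true mC mlin).
have iden b := integrable_target b mC mden integrable_denoiser.
rewrite -(@RintegralD _ _ _ (sigma_finite_prod lam lam2) _ _ _ mC
  (iden true) (iden false)).
(* The sum of the densities is [1 + posterior_odds] times the active one. This cancels the
   denominator of [gain] and leaves the inverse of [1 + e / beta], which is [c]. *)
apply: eq_Rintegral => y _; rewrite denoiserE frames_pdf_odds /gain /c.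
have q0 : 1 + posterior_odds y != 0.
  by rewrite gt_eqF// ltr_pwDl// posterior_odds_ge0.
move: (posterior_odds y) q0 (frames_pdf _ _) (u _) => q q0 F v.
by field; rewrite q0 !gt_eqF// addrC.
Qed.

End coordinate.

End model.

Theorem theorem1 (R : realType) (d : measure_display) (T : measurableType d)
    (P : probability T R) (M t : nat)
    (beta p01 p11 pa e eprev enext : R)
    (l : nat -> {RV P >-> bool}) (h z : nat -> {RV P >-> 'rV[R[i]]_M})
    (M_gt0 : (0 < M)%N) (t_gt0 : (0 < t)%N)
    (beta_gt0 : 0 < beta) (pa_gt0 : 0 < pa) (pa_lt1 : pa < 1)
    (e_gt0 : 0 < e) (eprev_gt0 : 0 < eprev) (enext_gt0 : 0 < enext)
    (chain_l : activity_chain l p01 p11 pa)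
    (law_h : forall tau, tau \in [:: t.-1; t; t.+1] ->
       has_cnormal_law P (h tau) beta)
    (law_z : forall tau, tau \in [:: t.-1; t; t.+1] ->
       has_cnormal_law P (z tau) 1)
    (indep : mutually_independent P (source_sigma t l h z)) :
  let x := signal l h in
  let r := observation l h z in
  [/\ is_inverse_likelihood_ratio P (r e t) (l t) (upsilon beta e),
      is_inverse_likelihood_ratio P (r eprev t.-1) (l t.-1)
        (upsilon beta eprev),
      is_inverse_likelihood_ratio P (r enext t.+1) (l t.+1)
        (upsilon beta enext) &
      is_cond_exp P (x t)
        (fun w => (r e t w, (r eprev t.-1 w, r enext t.+1 w)))
        (fun y => mmse_denoiser beta p01 p11 pa e eprev enext y.1 y.2)].
Proof.
case: t t_gt0 law_h law_z indep => // s _ law_h law_z indep x r.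
(* Variances indexed by the offset from frame [t - 1], which is [s]. The default branch covers
   offset 2 and keeps every value positive. *)
pose E k := match k with 0%N => eprev | 1%N => e | _ => enext end.
have E_gt0 k : 0 < E k by case: k => [|[|k]].
have frameP k : (k < 3)%N -> (s + k)%N \in [:: s.+1.-1; s.+1; s.+2].
  by case: k => [|[|[|k]]]// _; rewrite !inE ?addn0 ?addn1 ?addn2 eqxx ?orbT.
have law_h' k : (k < 3)%N -> has_cnormal_law P (h (s + k)%N) beta.
  by move=> k3; exact/law_h/frameP.
have law_z' k : (k < 3)%N -> has_cnormal_law P (z (s + k)%N) 1.
  by move=> k3; exact/law_z/frameP.
have ratio := inverse_likelihood_ratio_obs beta_gt0 pa_gt0 pa_lt1 E_gt0 chain_l
  law_h' law_z' indep.
have ratio0 := ratio 0%N isT; have ratio1 := ratio 1%N isT.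
have ratio2 := ratio 2%N isT.
rewrite addn0 in ratio0; rewrite addn1 in ratio1; rewrite addn2 in ratio2.
split => //.
have -> : (fun w => (r e s.+1 w, (r eprev s.+1.-1 w, r enext s.+2 w))) =
    fun w => (observation l h z (E 1%N) (s + 1)%N w,
      (observation l h z (E 0%N) (s + 0)%N w, observation l h z (E 2%N) (s + 2)%N w)).
  by apply/funext => w; rewrite addn0 addn1 addn2.
split; first exact: (measurable_denoiser beta_gt0 pa_gt0 pa_lt1 E_gt0 chain_l).
move=> j; have cRe := @real_coordinate_Re R M j; have cIm := @real_coordinate_Im R M j.
split.
- have iS := integrable_signal l beta_gt0 law_h'.
  by split; [exact: (iS _ cRe)|exact: (iS _ cIm)].
- have iD := integrable_denoiser beta_gt0 pa_gt0 pa_lt1 E_gt0 chain_l law_h' law_z'.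
  by split; [exact: (iD _ cRe)|exact: (iD _ cIm)].
- have main := Rintegral_denoiser beta_gt0 pa_gt0 pa_lt1 E_gt0 chain_l law_h' law_z' indep.
  by move=> B mB; congr Complex; [exact: (main _ cRe B mB)|exact: (main _ cIm B mB)].
Qed.
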